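(* Let $R$ be an integral domain and $T$ a $t$-linked overring of $R$. If $R$ is $w$-stable, then $T$ is $w'$-stable, where $w'$ denotes the $w$-operation of the domain $T$.
   Context: $R$ is an integral domain with quotient field $K\neq R$. For nonzero $R$-submodules $A,B$ of $K$, $(A:B)=\{x\in K: xB\subseteq A\}$; $E(I)=(I:I)$. For a nonzero fractional ideal $I$, $I_v=(R:(R:I))$, $I_t=\bigcup\{J_v: J\subseteq I\text{ nonzero finitely generated}\}$; $t\text{-Max}(R)$ is the set of ideals maximal among proper $t$-ideals (ideals with $I=I_t$). For a nonzero $R$-submodule $E$ of $K$, $E_w=\bigcap_{M\in t\text{-Max}(R)}ER_M$; $I$ is a $w$-ideal if $I=I_w$. $R$ is $w$-stable if every $w$-ideal $I$ of $R$ satisfies $(I(E(I):I))_w=E(I)$. An overring $T$ ($R\subseteq T\subseteq K$) is $t$-linked over $R$ if $T_w=T$. The $w'$-operation of $T$ is defined in the same way using $T$ in place of $R$ (with $t\text{-Max}(T)$), and $T$ is $w'$-stable if every $w'$-ideal $I$ of $T$ satisfies $(I(E(I):I))_{w'}=E(I)$. *)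

(* Defs.v *)
From mathcomp Require Import all_boot all_algebra.
Set Implicit Arguments. Unset Strict Implicit. Unset Printing Implicit Defensive.
Import GRing.Theory.
Local Open Scope ring_scope.

Section Defs.
Variable K : fieldType.

Definition kset := K -> Prop.
Definition seteq (A B : kset) := forall x, A x <-> B x.
Definition ksubset (A B : kset) := forall x, A x -> B x.
Definition nonzero (A : kset) := exists x, A x /\ x != 0.

(* D is a subring (with 1) of K; since K is a field, D is a domain *)
Definition subring (D : kset) :=
  [/\ D 1, (forall x y, D x -> D y -> D (x - y)) & (forall x y, D x -> D y -> D (x * y))].

Definition is_quotient_field (D : kset) :=
  forall x, exists a b, [/\ D a, D b, b != 0 & x = a / b].

Definition submod (D A : kset) :=
  [/\ A 0, (forall x y, A x -> A y -> A (x + y)) & (forall r a, D r -> A a -> A (r * a))].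

Definition colon (A B : kset) : kset := fun x => forall b, B b -> A (x * b).
Definition Eend (I : kset) : kset := colon I I.

Definition modprod (A B : kset) : kset := fun x =>
  exists s : seq (K * K), (forall p, p \in s -> A p.1 /\ B p.2) /\
    x = \sum_(p <- s) p.1 * p.2.

Definition vop (D I : kset) : kset := colon D (colon D I).

Definition span (D : kset) (s : seq K) : kset := fun x =>
  exists r : nat -> K, (forall i, D (r i)) /\ x = \sum_(i < size s) r i * s`_i.
Definition fin_gen (D J : kset) := exists s, seteq J (span D s).

Definition top (D I : kset) : kset := fun x =>
  exists J, [/\ fin_gen D J, nonzero J, ksubset J I & vop D J x].

Definition ideal (D I : kset) := submod D I /\ ksubset I D.
Definition proper (D I : kset) := exists x, D x /\ ~ I x.
Definition t_ideal (D I : kset) := [/\ ideal D I, nonzero I & seteq I (top D I)].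
Definition tmax (D M : kset) :=
  [/\ t_ideal D M, proper D M &
     forall N, t_ideal D N -> proper D N -> ksubset M N -> seteq N M].

Definition loc (D M : kset) : kset := fun x =>
  exists a s, [/\ D a, D s, ~ M s & x = a / s].

Definition wop (D E : kset) : kset := fun x =>
  forall M, tmax D M -> modprod E (loc D M) x.

Definition w_ideal (D I : kset) := [/\ ideal D I, nonzero I & seteq I (wop D I)].

Definition w_stable (D : kset) :=
  forall I, w_ideal D I ->
    seteq (wop D (modprod I (colon (Eend I) I))) (Eend I).

Definition t_linked (R T : kset) := seteq (wop R T) T.

End Defs.

(* Main.v *)
Require Import Defs.
From HB Require Import structures.
From mathcomp Require Import all_boot all_algebra.
From mathcomp Require Import boolp classical_sets.
From mathcomp Require Import ring.
Import Defs GRing.Theory.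
Set Implicit Arguments. Unset Strict Implicit. Unset Printing Implicit Defensive.
Local Open Scope ring_scope.

(* Localizing at a maximal [t]-ideal [M] of [R] gives a local domain [D] all of whose fractional
   ideals are stable.  Over such a [D] every [z] in [K] satisfies a quadratic equation with a unit
   coefficient, so the integral closure [W] of [D] is Bezout, and every fractional ideal is
   [I = w E(I)].  For an ideal [J] of an overring [T] of [D] there are two cases.  If [W] is
   fractional over [D], then [J = I T] for a fractional ideal [I] of [D].  Otherwise [W] is a
   valuation ring, the nonunits of [D] generate an ideal [a W] with [c / a^n] outside [W] for
   [n] large, whatever [c != 0], so [J] has an element [x] of least value and [x^-1 J] is a ring.
   In both cases [J = w E(J)] for some [w] in [J].

   Globally, stability of the [w]-closure of [sum_M c^2 (E(M) : M)] shows that a nonzero [c] lies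
   in finitely many maximal [t]-ideals.  Hence finitely many elements of a [w']-ideal [J] of [T]
   generate it locally at all maximal [t]-ideals of [R], which lets local stability
   descend to [J]; as [T] is [t]-linked, each maximal [t]-ideal of [T] contracts into a maximal
   [t]-ideal of [R]. *)

(** * Subrings, modules and integral elements *)

Lemma seteq_eq (K : fieldType) (A B : K -> Prop) : seteq A B -> A = B.
Proof. by move=> AB; apply/funext => x; apply/propext/AB. Qed.

Section Subring.
Variables (K : fieldType) (D : K -> Prop).
Hypothesis hD : subring D.

Lemma sr1 : D 1. Proof. by case: hD. Qed.
Lemma srB x y : D x -> D y -> D (x - y). Proof. by case: hD => _ + _; apply. Qed.
Lemma srM x y : D x -> D y -> D (x * y). Proof. by case: hD => _ _; apply. Qed.
Lemma sr0 : D 0. Proof. by rewrite -(subrr 1); apply: srB; exact: sr1. Qed.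
Lemma srN x : D x -> D (- x). Proof. by move=> Dx; rewrite -sub0r; apply: srB => //; exact: sr0. Qed.
Lemma srD x y : D x -> D y -> D (x + y).
Proof. by move=> Dx Dy; rewrite -[y]opprK; apply/srB/srN. Qed.
Lemma srX x n : D x -> D (x ^+ n).
Proof. by move=> Dx; elim: n => [|n IH]; [exact: sr1 | rewrite exprS; apply: srM]. Qed.
Lemma srMn x n : D x -> D (x *+ n).
Proof. by move=> Dx; elim: n => [|n IH]; [exact: sr0 | rewrite mulrS; apply: srD]. Qed.

End Subring.

Ltac sr := first [ assumption | match goal with
  | H : subring ?D |- ?D 0 => exact (sr0 H)
  | H : subring ?D |- ?D 1 => exact (sr1 H)
  | H : subring ?D |- ?D (_ + _) => apply (srD H); sr
  | H : subring ?D |- ?D (_ * _) => apply (srM H); sr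
  | H : subring ?D |- ?D (- _) => apply (srN H); sr
  | H : subring ?D |- ?D (_ ^+ _) => apply (srX H); sr
  | H : subring ?D |- ?D (_ *+ _) => apply (srMn H); sr
  | H : subring ?D |- ?D _ => first [ exact (sr0 H) | exact (sr1 H)
      | apply (srD H); sr | apply (srN H); sr | apply (srM H); sr | apply (srX H); sr | apply (srMn H); sr ]
  | H : ksubset ?D ?E |- ?E _ => apply H; sr
  | H : forall x, ?D x -> ?E x |- ?E _ => apply H; sr
  end ].

Section Module.
Variables (K : fieldType) (D A : K -> Prop).
Hypothesis hA : submod D A.

Lemma sm0 : A 0. Proof. by case: hA. Qed.
Lemma smD x y : A x -> A y -> A (x + y). Proof. by case: hA => _ + _; apply. Qed.
Lemma smZ r x : D r -> A x -> A (r * x). Proof. by case: hA => _ _; apply. Qed.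
Lemma smZr r x : D r -> A x -> A (x * r). Proof. by rewrite mulrC; exact: smZ. Qed.
Lemma smN x : subring D -> A x -> A (- x).
Proof. by move=> hD Ax; rewrite -mulN1r; apply: smZ; sr. Qed.
Lemma smB x y : subring D -> A x -> A y -> A (x - y).
Proof. by move=> hD Ax Ay; apply/smD/smN. Qed.

End Module.

Lemma submod_self (K : fieldType) (D : K -> Prop) : subring D -> submod D D.
Proof. by move=> hD; split=> *; sr. Qed.

Lemma submod_le (K : fieldType) (D E A : K -> Prop) :
  ksubset D E -> submod E A -> submod D A.
Proof. by move=> DE [A0 AD AZ]; split=> // r a /DE; exact: AZ. Qed.

Section ModProd.
Variables (K : fieldType) (A B : K -> Prop).

Lemma modprod_ind (P : K -> Prop) :
  P 0 -> (forall x y, P x -> P y -> P (x + y)) ->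
  (forall a b, A a -> B b -> P (a * b)) -> ksubset (modprod A B) P.
Proof.
move=> P0 PD PM _ [s [hs ->]].
elim: s hs => [|p s IH] hs; first by rewrite big_nil.
rewrite big_cons; apply: PD; first by apply: PM; case: (hs p (mem_head _ _)).
by apply: IH => q qs; apply: hs; rewrite in_cons qs orbT.
Qed.

Lemma modprodM a b : A a -> B b -> modprod A B (a * b).
Proof.
by move=> Aa Bb; exists [:: (a, b)]; split=> [p|]; rewrite ?big_seq1 // inE => /eqP ->.
Qed.

Lemma modprod0 : modprod A B 0.
Proof. by exists [::]; rewrite big_nil. Qed.

Lemma modprodD x y : modprod A B x -> modprod A B y -> modprod A B (x + y).
Proof.
move=> [s [hs ->]] [t [ht ->]]; exists (s ++ t); rewrite big_cat; split=> // p.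
by rewrite mem_cat => /orP [/hs|/ht].
Qed.

End ModProd.

Lemma modprodZ (K : fieldType) (A B : K -> Prop) (r : K) : 
  (forall x, A x -> A (r * x)) -> forall x, modprod A B x -> modprod A B (r * x).
Proof.
move=> hr; apply: modprod_ind => [|x y|a b Aa Bb].
- by rewrite mulr0; exact: modprod0.
- by rewrite mulrDr; exact: modprodD.
- by rewrite mulrA; apply: modprodM => //; exact: hr.
Qed.

Lemma submod_modprod (K : fieldType) (D A B : K -> Prop) :
  submod D A -> submod D (modprod A B).
Proof.
move=> hA; split=> [|x y|r x Dr]; [exact: modprod0|exact: modprodD|].
by apply: modprodZ => a Aa; exact: (smZ hA Dr Aa).
Qed.

Lemma subring_modprod (K : fieldType) (A B : K -> Prop) :
  subring A -> subring B -> subring (modprod A B).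
Proof.
move=> hA hB; have hm := submod_modprod B (submod_self hA); split.
- by rewrite -[1]mulr1; apply: modprodM; exact: sr1.
- by move=> x y *; apply: (smB hm).
- move=> x y hx hy; move: x hx; apply: modprod_ind => [|x z|a b Aa Bb].
  + by rewrite mul0r; exact: modprod0.
  + by rewrite mulrDl; exact: modprodD.
  move: y hy; apply: modprod_ind => [|x z|a' b' Aa' Bb'].
  + by rewrite mulr0; exact: modprod0.
  + by rewrite mulrDr; exact: modprodD.
  + by rewrite mulrACA; apply: modprodM; exact: srM.
Qed.

Section Integral.
Variables (K : fieldType) (D : K -> Prop).

Definition intg (x : K) : Prop :=
  exists p : {poly K}, [/\ p \is monic, forall i, D p`_i & root p x].

Hypothesis hD : subring D.

(** The proof of [subring D] is an argument so that the instances can be keyed on it. They turn [D]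
    into a ring type, to which the closure properties of [integralOver] apply. *)
Definition subring_pred (_ : subring D) : {pred K} := fun x => `[< D x >].

Fact subring_pred_closed : subring_closed (subring_pred hD).
Proof.
by split=> [|x y|x y]; rewrite ?unfold_in; [apply/asboolP; sr
 | move=> /asboolP ? /asboolP ?; apply/asboolP; sr
 | move=> /asboolP ? /asboolP ?; apply/asboolP; sr].
Qed.
HB.instance Definition _ := GRing.isSubringClosed.Build K (subring_pred hD) subring_pred_closed.

Definition sub_type := {x : K | x \in subring_pred hD}.
HB.instance Definition _ := SubChoice.on sub_type.
HB.instance Definition _ := [SubChoice_isSubComNzRing of sub_type by <:].

Let iota : {rmorphism sub_type -> K} := \val.

Lemma intgE x : intg x <-> integralOver iota x.
Proof.
split=> [[p [mp Dp rp]]|[q mq rq]].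
  have [q pq] : exists q : {poly sub_type}, p = map_poly iota q.
    exists (\poly_(i < size p) insubd (0 : sub_type) p`_i).
    apply/polyP => i; rewrite coef_map coef_poly; case: ltnP => [_|/(nth_default 0) ->] //=.
    by rewrite val_insubd unfold_in asboolT.
  exists q; last by rewrite -pq.
  move: mp; rewrite pq !monicE lead_coef_map_inj ?rmorph0 //; exact: val_inj.
exists (map_poly iota q); split=> //; first exact: monic_map.
by move=> i; rewrite coef_map; apply/asboolP; exact: (valP q`_i).
Qed.

Lemma intg_in x : D x -> intg x.
Proof.
move=> Dx; exists ('X - x%:P); split; first exact: monicXsubC.
  move=> i; rewrite coefB coefX coefC; apply: srB => //; case: eqP => _; sr.
by rewrite root_XsubC.
Qed.

Lemma intg_subring : subring intg.
Proof.
split=> [|x y /intgE ix /intgE iy|x y /intgE ix /intgE iy].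
- apply: intg_in; sr.
- by apply/intgE/integral_sub.
- by apply/intgE/integral_mul.
Qed.

Lemma intg_quad x l m : D l -> D m -> x ^+ 2 = l * x + m -> intg x.
Proof.
move=> Dl Dm hx; exists ('X^2 - (l *: 'X + m%:P)); split.
- rewrite monicE lead_coefDl ?lead_coefXn // size_polyN size_polyXn.
  apply: leq_ltn_trans (size_polyD _ _) _; rewrite gtn_max.
  by rewrite (leq_ltn_trans (size_scale_leq _ _)) ?size_polyX //
    (leq_ltn_trans (size_polyC_leq1 _)).
- move=> i; rewrite coefB coefD coefXn coefZ coefX coefC.
  by case: (i == 2)%N; case: (i == 1)%N; case: (i == 0)%N; rewrite /= ?mulr1 ?mulr0; sr.
- by rewrite /root !hornerE hx subrr.
Qed.

(* Dividing the monic equation of [u^-1] by a power of [u^-1] expresses [u^-1] as a polynomial in [u]. *)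
Lemma intg_inv u : D u -> u != 0 -> intg u^-1 -> D u^-1.
Proof.
move=> Du u0 [p [mp Dp /rootP rp]].
have p0 : (0 < size p)%N by rewrite size_poly_gt0 monic_neq0.
have u1 : size p != 1%N.
  apply/negP => /eqP sp; move: rp; rewrite (size1_polyC (eq_leq sp)) hornerC.
  by move: mp; rewrite monicE lead_coefE sp /= => /eqP ->; apply/eqP; exact: oner_neq0.
case sp: (size p) => [|[|n]]; rewrite sp // in p0 u1.
have lp : p`_n.+1 = 1 by move: mp; rewrite monicE lead_coefE sp => /eqP.
move: rp; rewrite horner_coef sp big_ord_recr /= lp mul1r => /eqP.
rewrite addrC addr_eq0 => /eqP hp.
have -> : u^-1 = u ^+ n * u^-1 ^+ n.+1.
  by rewrite exprS exprVn mulrCA divff ?expf_neq0 ?mulr1.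
rewrite hp.
rewrite mulrN; apply: srN => //; rewrite mulr_sumr.
elim/big_ind: _ => [|x y|i _]; [sr|by move=> *; sr|].
have -> : u ^+ n * (p`_i * u^-1 ^+ i) = p`_i * u ^+ (n - i).
  rewrite mulrCA exprVn -expfB_cond //; last by rewrite (negPf u0) add0n -ltnS.
by apply: (srM hD); [exact: Dp | sr].
Qed.
End Integral.

Lemma intg_le (K : fieldType) (D E : K -> Prop) :
  ksubset D E -> ksubset (intg D) (intg E).
Proof. by move=> DE x [p [mp Dp rp]]; exists p; split=> // i; exact: DE. Qed.

(** * Overrings of a stable local domain *)

Section LocalDefs.
Variables (K : fieldType) (D : K -> Prop).

Definition runit x := [/\ D x, x != 0 & D x^-1].
Definition nonunit x := D x /\ ~ runit x.
Definition fractional (I : K -> Prop) := exists d, d != 0 /\ forall x, I x -> D (d * x).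
(** For a module [I] this makes w^-1 I a ring, which must be E(I); hence I = w E(I). *)
Definition prin (I : K -> Prop) :=
  exists w, [/\ I w, w != 0 & forall y z, I y -> I z -> I (y * z / w)].
Definition lin3 (x y z : K) : K -> Prop :=
  fun v => exists a b c, [/\ D a, D b, D c & v = a * x + b * y + c * z].
Definition quad x := exists l m, [/\ D l, D m & x ^+ 2 = l * x + m].

Hypothesis hD : subring D.

Lemma lin3_submod x y z : submod D (lin3 x y z).
Proof.
split=> [|_ _ [a [b [c [? ? ? ->]]]] [a' [b' [c' [? ? ? ->]]]]|r _ ? [a [b [c [? ? ? ->]]]]].
- by exists 0, 0, 0; split; [sr|sr|sr|ring].
- by exists (a + a'), (b + b'), (c + c'); split; [sr|sr|sr|ring].
- by exists (r * a), (r * b), (r * c); split; [sr|sr|sr|ring].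
Qed.

Lemma lin3_1 x y z : lin3 x y z x.
Proof. by exists 1, 0, 0; split; [sr|sr|sr|ring]. Qed.
Lemma lin3_2 x y z : lin3 x y z y.
Proof. by exists 0, 1, 0; split; [sr|sr|sr|ring]. Qed.
Lemma lin3_3 x y z : lin3 x y z z.
Proof. by exists 0, 0, 1; split; [sr|sr|sr|ring]. Qed.

Lemma lin3_sub (A : K -> Prop) x y z :
  submod D A -> A x -> A y -> A z -> ksubset (lin3 x y z) A.
Proof.
move=> hA Ax Ay Az _ [a [b [c [? ? ? ->]]]].
by apply: (smD hA); [apply: (smD hA)|]; apply: (smZ hA).
Qed.

Hypothesis hq : is_quotient_field D.

Lemma common_denominator x y z :
  exists d, [/\ D d, d != 0, D (d * x), D (d * y) & D (d * z)].
Proof.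
have [a [b [Da Db b0 ->]]] := hq x; have [a' [b' [Da' Db' b0' ->]]] := hq y.
have [a'' [b'' [Da'' Db'' b0'' ->]]] := hq z.
exists (b * b' * b''); split; first sr; first by rewrite !mulf_neq0.
- have -> : b * b' * b'' * (a / b) = a * b' * b'' by field.
  sr.
- have -> : b * b' * b'' * (a' / b') = b * a' * b'' by field.
  sr.
- have -> : b * b' * b'' * (a'' / b'') = b * b' * a'' by field.
  sr.
Qed.

Lemma lin3_fractional x y z : fractional (lin3 x y z).
Proof.
have [d [Dd d0 Dx Dy Dz]] := common_denominator x y z; exists d; split=> // v.
move=> [a [b [c [? ? ? ->]]]].
have -> : d * (a * x + b * y + c * z) = a * (d * x) + b * (d * y) + c * (d * z) by ring.
sr.
Qed.

End LocalDefs.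

Section Local.
Variables (K : fieldType) (D : K -> Prop).
Hypothesis hD : subring D.
Hypothesis hq : is_quotient_field D.
Hypothesis hloc : forall x y, nonunit D x -> nonunit D y -> nonunit D (x + y).
(** The second factor is (E(I) : I), so this is I (E(I) : I) = E(I) tested at 1. *)
Hypothesis hst : forall I, submod D I -> nonzero I -> fractional D I ->
  modprod I (fun g => forall y z, I y -> I z -> I (g * y * z)) 1.

Let m := nonunit D.
Let W := intg D.
Let hW : subring W := intg_subring hD.
Let DW : ksubset D W := @intg_in K D hD.

Lemma nonunit_in x : m x -> D x. Proof. by case. Qed.

Lemma unit_or_nonunit x : D x -> runit D x \/ m x.
Proof. by move=> Dx; case: (pselect (runit D x)); [left|right]. Qed.

Lemma runit1 : runit D 1.
Proof. by split; rewrite ?invr1 ?oner_neq0 //; sr. Qed.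

Lemma nonunit1_F : ~ m 1.
Proof. by case=> _; apply; exact: runit1. Qed.

Lemma nonunit0 : m 0.
Proof. by split; [sr | case; rewrite eqxx]. Qed.

Lemma nonunitMl r x : D r -> m x -> m (r * x).
Proof.
move=> Dr [Dx nx]; split; first sr.
move=> [_]; rewrite mulf_eq0 negb_or invfM => /andP [r0 x0] Drx; apply: nx; split=> //.
have -> : x^-1 = r * (r^-1 * x^-1) by field; rewrite r0 x0.
sr.
Qed.

Lemma nonunitMr r x : D r -> m x -> m (x * r).
Proof. by rewrite mulrC; exact: nonunitMl. Qed.

Lemma nonunitN x : m x -> m (- x).
Proof. by move=> mx; rewrite -mulN1r; apply: nonunitMl => //; sr. Qed.

Lemma nonunit_submod : submod D m.
Proof. by split; [exact: nonunit0 | exact: hloc | exact: nonunitMl]. Qed.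

Lemma runit_1B x : m x -> runit D (1 - x).
Proof.
move=> mx; have [//|m1] := unit_or_nonunit (srB hD (sr1 hD) (nonunit_in mx)).
by case: nonunit1_F; rewrite -(subrK x 1); exact: hloc.
Qed.

Lemma runitM x y : runit D x -> runit D y -> runit D (x * y).
Proof. by case=> Dx x0 Dx' [Dy y0 Dy']; split; rewrite ?mulf_neq0 ?invfM //; sr. Qed.

Lemma runitV x : runit D x -> runit D x^-1.
Proof. by case=> Dx x0 Dx'; split; rewrite ?invr_eq0 ?invrK. Qed.

(** Suppose all relations have all coefficients in [m], and let I = D + Dz. For g in (E(I) : I),
    comparing the expressions of g, gz and gz^2 in I gives relations that force g and gz into m +
    mz. So 1 = a + bz with a, b in [m], a relation with the unit coefficient 1 - a. *)
Lemma primitive_quadratic z : exists a b c,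
  [/\ D a, D b, D c, a + b * z + c * z ^+ 2 = 0 & [\/ runit D a, runit D b | runit D c]].
Proof.
apply: contrapT => np.
have nu_rel a b c : D a -> D b -> D c -> a + b * z + c * z ^+ 2 = 0 -> [/\ m a, m b & m c].
  move=> Da Db Dc e; split; split=> // u; apply: np; exists a, b, c; split=> //.
  - by constructor 1.
  - by constructor 2.
  - by constructor 3.
pose I := lin3 D 1 z 0.
have hI : submod D I by exact: lin3_submod.
have I1 : I 1 by exact: lin3_1.
have Iz : I z by exact: lin3_2.
have I1' : nonzero I by exists 1; rewrite oner_neq0.
have IP x : I x -> exists a b, [/\ D a, D b & x = a + b * z].
  by case=> a [b [c [Da Db Dc ->]]]; exists a, b; split=> //; ring.
pose P x := exists a b, [/\ m a, m b & x = a + b * z].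
have PZ r x : D r -> P x -> P (r * x).
  by move=> Dr [a [b [ma mb ->]]]; exists (r * a), (r * b); split; [exact: nonunitMl|exact: nonunitMl|ring].
have PD x y : P x -> P y -> P (x + y).
  move=> [a [b [ma mb ->]]] [a' [b' [ma' mb' ->]]].
  by exists (a + a'), (b + b'); split; [exact: hloc|exact: hloc|ring].
have : P 1.
  apply: (modprod_ind _ PD _ (hst hI I1' (lin3_fractional hD hq _ _ _))).
    by exists 0, 0; split; [exact: nonunit0|exact: nonunit0|ring].
  move=> f g If Ig.
  have [a [b [Da Db eg]]] := IP _ (Ig _ _ I1 I1).
  have [a1 [b1 [Da1 Db1 eg1]]] := IP _ (Ig _ _ I1 Iz).
  have [a2 [b2 [Da2 Db2 eg2]]] := IP _ (Ig _ _ Iz Iz).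
  rewrite !mulr1 in eg eg1.
  have [ma1 mab mb] := @nu_rel (- a1) (a - b1) b ltac:(sr) ltac:(sr) ltac:(sr)
    ltac:(rewrite -(subrr (g * z)) {2}eg1 eg; ring).
  have [ma2 mab1 mb1] := @nu_rel (- a2) (a1 - b2) b1 ltac:(sr) ltac:(sr) ltac:(sr)
    ltac:(rewrite -(subrr (g * z * z)) {2}eg2 eg1; ring).
  have ma : m a by rewrite -(subrK b1 a); exact: hloc.
  have {}ma1 : m a1 by rewrite -[a1]opprK; exact: nonunitN.
  have [r [t [Dr Dt ->]]] := IP _ If.
  have -> : (r + t * z) * g = r * g + t * (g * z) by ring.
  by apply: PD; apply: PZ => //; [exists a, b | exists a1, b1].
move=> [a [b [ma mb e1]]].
have Da := nonunit_in ma; have Db := nonunit_in mb.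
have [u _ _] := @nu_rel (1 - a) (- b) 0 ltac:(sr) ltac:(sr) ltac:(sr)
  ltac:(rewrite {1}e1; ring).
by case: u => _; apply; exact: runit_1B.
Qed.

(** The cases are: c is a unit, a is a unit, only b is a unit. In the last one A + z + C z^2 = 0
    with A, C in [m], and t = 1/(1+z) satisfies a monic equation that reduces to t^2 = l t modulo
    [m]. *)
Lemma quadratic_trichotomy z :
  [\/ quad D z, z != 0 /\ quad D z^-1 | 1 + z != 0 /\
    exists l mu, [/\ runit D l, m mu & (1 + z)^-1 ^+ 2 = l * (1 + z)^-1 + mu]].
Proof.
have [a [b [c [Da Db Dc e h]]]] := primitive_quadratic z.
have [[_ c0 Dc']|mc] := unit_or_nonunit Dc.
  constructor 1; exists (- (b * c^-1)), (- (a * c^-1)); split; [sr|sr|].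
  apply: (mulfI c0); rewrite -[LHS]subr0 -e; field.
  by rewrite c0.
have [[_ a0 Da']|ma] := unit_or_nonunit Da.
  have z0 : z != 0.
    by apply: contraNneq a0 => z0; rewrite -e z0; apply/eqP; ring.
  constructor 2; split=> //; exists (- (b * a^-1)), (- (c * a^-1)); split; [sr|sr|].
  apply: (mulfI a0); apply: (mulfI (expf_neq0 2 z0)); rewrite -[LHS]subr0 -e; field.
  by rewrite a0 z0.
have [_ b0 Db'] : runit D b by case: h => // u; [case: ma|case: mc].
have mA := nonunitMr Db' ma; have mC := nonunitMr Db' mc.
set A := a * b^-1 in mA; set C := c * b^-1 in mC.
have {}e : A + z + C * z ^+ 2 = 0.
  by apply: (mulfI b0); rewrite mulr0 -e /A /C; field; rewrite b0.
have u : runit D (1 - (A + C)) by apply/runit_1B/hloc.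
have t0 : 1 + z != 0.
  case: u => _ + _; apply: contraNneq => /eqP; rewrite addrC addr_eq0 => /eqP z1.
  by rewrite z1 in e; rewrite -oppr0 -e; apply/eqP; ring.
constructor 3; split=> //.
exists ((1 - (C + C)) * (1 - (A + C))^-1), (C * (1 - (A + C))^-1); split.
- by apply: runitM; [apply/runit_1B/hloc | exact: runitV].
- by apply: nonunitMr => //; case: u.
case: u => _ u0 _; apply: (mulfI u0); apply: (mulfI (expf_neq0 2 t0)).
rewrite -[LHS]addr0 -e; field.
by rewrite u0 t0.
Qed.

Lemma quad_W x : quad D x -> W x.
Proof. by case=> l [n [Dl Dn e]]; exact: intg_quad e. Qed.

(** The three choices of w match the three cases for z/y. Each lies in every additive set containing
    y and z. *)
Lemma gcd_W y z : exists w, [\/ w = y, w = z | w = y + z] /\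
  exists p q, [/\ W p, W q, y = w * p & z = w * q].
Proof.
have [y0|y0] := eqVneq y 0.
  by exists z; split; [constructor 2 | exists 0, 1; split; [sr|sr|rewrite y0; ring|ring]].
case: (quadratic_trichotomy (z / y)) => [q|[z0 q]|[t0 [l [n [[Dl _ _] [Dn _] e]]]]].
- exists y; split; first by constructor 1.
  by exists 1, (z / y); split; [sr|exact: quad_W|ring|field].
- exists z; split; first by constructor 2.
  have zn : z != 0 by move: z0; rewrite mulf_eq0 negb_or => /andP [].
  by exists (z / y)^-1, 1; split; [exact: quad_W|sr|field; rewrite ?zn ?y0|ring].
- exists (y + z); split; first by constructor 3.
  have Wt : W (1 + z / y)^-1 by exact: intg_quad e.
  have tn : y + z != 0 by have -> : y + z = y * (1 + z / y) by [field]; rewrite mulf_neq0.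
  exists (1 + z / y)^-1, (1 - (1 + z / y)^-1); split; [by []|sr| |]; field.
    by rewrite y0 tn.
  by rewrite y0 tn.
Qed.

Lemma gcd_seq (A : K -> Prop) (s : seq K) :
  A 0 -> (forall x y, A x -> A y -> A (x + y)) -> (forall x, x \in s -> A x) ->
  exists2 w, A w & forall x, x \in s -> exists2 p, W p & x = w * p.
Proof.
move=> A0 AD; elim: s => [|y s IH] hs; first by exists 0.
have [w Aw hw] : exists2 w, A w & forall x, x \in s -> exists2 p, W p & x = w * p.
  by apply: IH => x xs; apply: hs; rewrite in_cons xs orbT.
have Ay : A y by apply: hs; rewrite mem_head.
have [v [hv [p [q [Wp Wq ey ew]]]]] := gcd_W y w.
exists v; first by case: hv => ->; auto.
move=> x; rewrite in_cons => /orP [/eqP ->|/hw [r Wr ->]]; first by exists p.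
by exists (q * r); [sr | rewrite ew mulrA].
Qed.

Lemma eend_subring (I : K -> Prop) : submod D I -> subring (Eend I).
Proof.
move=> hI; split=> [y|x y Ix Iy z Iz|x y Ix Iy z Iz].
- by rewrite mul1r.
- by rewrite mulrBl; apply: (smB hI) => //; [exact: Ix | exact: Iy].
- by rewrite -mulrA; apply/Ix/Iy.
Qed.

(** Taking gcds over [W] in both factors of 1 = sum f_i g_i gives 1 = w v u with w in I, v in (E(I)
    : I) and u in [W]. Then v w is in E(I) and its inverse u is integral over E(I), so v w is a unit
    of E(I). *)
Lemma fractional_prin (I : K -> Prop) :
  submod D I -> nonzero I -> fractional D I -> prin I.
Proof.
move=> hI nI fI.
set G := fun g => forall y z, I y -> I z -> I (g * y * z).
have [s [hs e1]] : modprod I G 1 := hst hI nI fI.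
have [w Iw hw] : exists2 w, I w & forall x, x \in map fst s -> exists2 p, W p & x = w * p.
  apply: gcd_seq => [|x y|x /mapP [p /hs [Ip _] ->]] //; [exact: sm0 hI | exact: (smD hI)].
have [v Gv hv] : exists2 v, G v & forall x, x \in map snd s -> exists2 p, W p & x = v * p.
  apply: gcd_seq => [y z _ _|x y Gx Gy z t Iz It|x /mapP [p /hs [_ Ip] ->]] //.
    by rewrite !mul0r; exact: sm0 hI.
  by rewrite !mulrDl; apply: (smD hI); [exact: Gx | exact: Gy].
have [u Wu eu] : exists2 u, W u & \sum_(p <- s) p.1 * p.2 = w * v * u.
  rewrite big_seq; elim/big_ind: _ => [|_ _ [a Wa ->] [b Wb ->]|p ps].
  - by exists 0; [sr | rewrite mulr0].
  - by exists (a + b); [sr | rewrite mulrDr].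
  have [a Wa ->] := hw _ (map_f fst ps); have [b Wb ->] := hv _ (map_f snd ps).
  by exists (a * b); [sr | rewrite mulrACA].
rewrite eu in e1.
have x0 : w * v * u != 0 by rewrite -e1 oner_neq0.
move: x0; rewrite !mulf_eq0 !negb_or => /andP [/andP [w0 v0] u0].
have uE : u = (v * w)^-1.
  by apply: (mulfI (mulf_neq0 v0 w0)); rewrite divff ?mulf_neq0 // e1; ring.
have hE := eend_subring hI.
have EV : Eend I (v * w)^-1.
  apply: (intg_inv hE); [|by rewrite mulf_neq0|].
    by move=> y Iy; exact: Gv.
  rewrite -uE; apply: (intg_le _ Wu) => d Dd y; exact: (smZ hI).
exists w; split=> // y z Iy Iz.
have -> : y * z / w = (v * w)^-1 * (v * y * z) by field; rewrite v0 w0.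
by apply: EV; exact: Gv.
Qed.

Lemma prin_subring (I : K -> Prop) w : submod D I -> I w -> w != 0 ->
  (forall y z, I y -> I z -> I (y * z / w)) -> subring (fun x => I (w * x)).
Proof.
move=> hI Iw w0 hw; split=> [|x y Ix Iy|x y Ix Iy].
- by rewrite mulr1.
- by rewrite mulrBr; exact: (smB hI).
- have -> : w * (x * y) = w * x * (w * y) / w by field.
  exact: hw.
Qed.

(** Write I = w S with S a ring. Since 1 is in I, 1/w is in S; its inverse w is integral over D,
    hence also in S. So w is a unit of S and I = S. *)
Lemma fractional_ring (I : K -> Prop) : submod D I -> fractional D I -> I 1 ->
  ksubset I W -> forall y z, I y -> I z -> I (y * z).
Proof.
move=> hI fI I1 IW y z Iy Iz.
have [|w [Iw w0 hw]] := fractional_prin hI _ fI; first by exists 1; rewrite oner_neq0.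
have hS := prin_subring hI Iw w0 hw.
have Sw : I (w * w).
  rewrite -{2}[w]invrK; apply: (intg_inv hS); rewrite ?invr_eq0 // ?divff //.
  rewrite invrK; apply: (intg_le _ (IW _ Iw)) => d Dd; exact: (smZr hI).
have -> : y * z = y * z / w * (w * w) / w by field.
by apply: (hw) => //; exact: hw.
Qed.

Lemma W_quad x : W x -> quad D x.
Proof.
move=> Wx; have hI : submod D (lin3 D 1 x 0) by exact: lin3_submod.
have [] := @fractional_ring _ hI _ _ _ x x.
- exact: lin3_fractional.
- exact: lin3_1.
- by apply: lin3_sub; [exact: submod_le DW (submod_self hW)|sr|sr|sr].
- exact: lin3_2.
- exact: lin3_2.
move=> a [b [c [Da Db Dc e]]]; exists b, a; split=> //; rewrite expr2 e; ring.
Qed.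

(* First [c^2 D[1/s]] is contained in [D]; then stability of [I = D[1/s] + D z] puts [1/s] into
   [E(I)], which forces [z] into [D[1/s]]. *)
Lemma W_fractional_of_divisible s c : m s -> s != 0 -> D c -> c != 0 ->
  (forall j, W (c / s ^+ j)) -> fractional D W.
Proof.
move=> ms s0 Dc c0 hc; have Ds := nonunit_in ms.
(* Multiply the quadratic equation of c/s^j by s^j. *)
have hc2 j : D (c ^+ 2 / s ^+ j).
  have [l [n [Dl Dn e]]] := W_quad (hc j).
  have -> : c ^+ 2 / s ^+ j = l * c + n * s ^+ j.
    have sj : s ^+ j != 0 by rewrite expf_neq0.
    have -> : l * c + n * s ^+ j = s ^+ j * (l * (c / s ^+ j) + n) by field.
    by rewrite -e; field.
  sr.
exists (c ^+ 2); split=> [|z Wz]; first by rewrite expf_neq0.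
pose L x := exists j, D (s ^+ j * x).
have LZ r x : D r -> L x -> L (r * x).
  by move=> Dr [j Lx]; exists j; rewrite mulrCA; sr.
have LD x y : L x -> L y -> L (x + y).
  move=> [j Lx] [k Ly]; exists (j + k)%N.
  have -> : s ^+ (j + k) * (x + y) = s ^+ k * (s ^+ j * x) + s ^+ j * (s ^+ k * y).
    by rewrite exprD; ring.
  sr.
have LV x : L x -> L (x / s).
  by move=> [j Lx]; exists j.+1; rewrite exprS; have -> : s * s ^+ j * (x / s) = s ^+ j * x by field.
have LD0 x : D x -> L x by move=> Dx; exists 0%N; rewrite mul1r.
pose I x := exists a r, [/\ L a, D r & x = a + r * z].
have LI x : L x -> I x by move=> Lx; exists x, 0; split; [by []|sr|ring].
have hI : submod D I.
  split=> [|_ _ [a [r [La Dr ->]]] [a' [r' [La' Dr' ->]]]|t _ Dt [a [r [La Dr ->]]]].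
  - by apply/LI/LD0; sr.
  - by exists (a + a'), (r + r'); split; [exact: LD|sr|ring].
  - by exists (t * a), (t * r); split; [exact: LZ|sr|ring].
have fI : fractional D I.
  have [d [Dd d0 Ddz _ _]] := common_denominator hD hq z z z.
  exists (c ^+ 2 * d); split; first by rewrite mulf_neq0 ?expf_neq0.
  move=> _ [a [r [[j La] Dr ->]]].
  have -> : c ^+ 2 * d * (a + r * z) = c ^+ 2 / s ^+ j * (s ^+ j * a) * d + c ^+ 2 * r * (d * z).
    by field; rewrite expf_neq0.
  by have := hc2 j => ?; sr.
have I1 : I 1 by apply/LI/LD0; sr.
have [|w [Iw w0 hw]] := fractional_prin hI _ fI; first by exists 1; rewrite oner_neq0.
have hS := prin_subring hI Iw w0 hw.
have DS : ksubset D (fun x => I (w * x)) by move=> d Dd; exact: (smZr hI).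
have hiS := intg_subring hS.
have IS x : I x -> intg (fun x => I (w * x)) (x / w).
  by move=> Ix; apply: (intg_in hS); have -> : w * (x / w) = x by field.
(* With S = w^-1 I, this says that 1/s is in S. Dividing w = a + r z by s w shows 1/s integral over
   S, because a/s and r/s remain in D[1/s]. *)
have SV : I (w / s).
  apply: (intg_inv hS) => //; first exact: DS.
  have [a [r [La Dr ew]]] := Iw.
  have -> : s^-1 = a / s / w + r / s / w * z.
    by apply: (mulfI w0); rewrite {1}ew; field; rewrite w0 s0.
  apply: (srD hiS); first by apply/IS/LI/LV.
  by apply: (srM hiS); [apply/IS/LI/LV/LD0 | exact: (intg_le DS)].
have Iz : I z by exists 0, 1; split; [apply: LD0; sr|sr|ring].
have : I (z / s) by have := hw _ _ SV Iz; have -> : w / s * z / w = z / s by field; rewrite s0 w0.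
move=> [a [r [[j La] Dr ez]]].
have [_ u0 Du] := runit_1B (nonunitMl Dr ms).
have zE : z = s * a * (1 - r * s)^-1.
  have -> : a = z / s - r * z by rewrite ez; ring.
  by field; rewrite s0 u0.
have -> : c ^+ 2 * z = c ^+ 2 / s ^+ j * (s * (s ^+ j * a) * (1 - r * s)^-1).
  by rewrite {1}zE; field; rewrite u0 expf_neq0.
by have := hc2 j => ?; sr.
Qed.

(** Since eta (1 - eta) = -mu, it suffices to invert 1 - eta inside D + D eta. Up to the unit 1 - a
    it is 1 - c1 z, whose product with the conjugate 1 - c1 (l - z) is a unit of D. So the inverse
    is integral, hence already in the ring D + D eta. *)
Lemma split_in_D z a c eta mu : W z -> m a -> m c -> m mu ->
  eta = a + c * z -> eta ^+ 2 = eta + mu -> D eta.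
Proof.
move=> Wz ma mc mmu e1 e2.
have [Da Dc Dmu] : [/\ D a, D c & D mu] by split; exact: nonunit_in.
have [_ u0 Du] := runit_1B ma.
have [l [n [Dl Dn ez]]] := W_quad Wz.
pose c1 := c * (1 - a)^-1.
have mc1 : m c1 by exact: nonunitMr.
have Dc1 := nonunit_in mc1.
have mN : m (c1 * (l + c1 * n)) by apply: nonunitMr => //; sr.
have [_ N0 DN] := runit_1B mN.
have etaW : W eta by rewrite e1; sr.
have inv : (1 - eta) * ((1 - c1 * l + c1 * z) * (1 - a)^-1 * (1 - c1 * (l + c1 * n))^-1) = 1.
  have -> : 1 - eta = (1 - a) * (1 - c1 * z) by rewrite e1 /c1; field.
  have h : (1 - c1 * z) * (1 - c1 * l + c1 * z) = 1 - c1 * (l + c1 * n).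
    have -> : (1 - c1 * z) * (1 - c1 * l + c1 * z)
      = 1 - c1 * l + c1 ^+ 2 * l * z - c1 ^+ 2 * z ^+ 2 by ring.
    by rewrite ez; ring.
  set X := 1 - c1 * z in h *; set Y := 1 - c1 * l + c1 * z in h *.
  move: (N0); rewrite -h mulf_eq0 negb_or => /andP [X0 Y0].
  by field; rewrite X0 Y0 u0.
have v0 : 1 - eta != 0 by apply: contra_eqT inv; rewrite negbK => /eqP ->; rewrite mul0r eq_sym oner_neq0.
have WV : W (1 - eta)^-1.
  have -> : (1 - eta)^-1 = (1 - c1 * l + c1 * z) * (1 - a)^-1 * (1 - c1 * (l + c1 * n))^-1.
    by apply: (mulfI v0); rewrite inv divff.
  sr.
have hS : subring (lin3 D 1 eta 0).
  split=> [|x y|]; [exact: lin3_1|apply: (smB (lin3_submod hD _ _ _)) => //|].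
  move=> _ _ [x [y [? [Dx Dy _ ->]]]] [x' [y' [? [Dx' Dy' _ ->]]]].
  exists (x * x' + y * y' * mu), (x * y' + y * x' + y * y'), 0; split; [sr|sr|sr|].
  rewrite !mulr0 !addr0 !mulr1.
  have -> : (x + y * eta) * (x' + y' * eta) = x * x' + (x * y' + y * x') * eta + y * y' * eta ^+ 2 by ring.
  by rewrite e2; ring.
have : lin3 D 1 eta 0 (1 - eta)^-1.
  apply: (intg_inv hS) => //.
    by exists 1, (- 1), 0; split; [sr|sr|sr|ring].
  apply: (intg_le _ WV) => d Dd; exists d, 0, 0; split; [sr|sr|sr|ring].
move=> [x [y [t [Dx Dy Dt ev]]]].
have [_ w0 Dw] := runit_1B (nonunitMl (srN hD Dy) mmu).
have -> : eta = - (mu * x) * (1 - - y * mu)^-1.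
  have h : eta = - mu * (x + y * eta).
    have -> : x + y * eta = (1 - eta)^-1 by rewrite ev; ring.
    have -> : mu = eta ^+ 2 - eta by rewrite e2; ring.
    by field.
  have -> : mu * x = - eta * (1 - - y * mu) by rewrite mulrBr mulr1 {1}h; ring.
  by field.
sr.
Qed.

(* Modulo the nonunits, [zeta] is a nontrivial idempotent.  The primitive quadratic equations of
   [z + zeta / (1 - zeta)] and [z + (1 - zeta) / zeta] show that both components of [z] are scalar. *)
Lemma split_generates zeta mu : W zeta -> ~ D zeta -> m mu -> zeta ^+ 2 = zeta + mu ->
  forall z, W z -> exists a b, [/\ D a, D b & z = a + b * zeta].
Proof.
move=> Wzeta nD mmu ezeta z Wz; apply: contrapT => nz.
have Dmu := nonunit_in mmu.
pose I := lin3 D 1 zeta z; pose mI := lin3 m 1 zeta z.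
have hI : submod D I by exact: lin3_submod.
have I1 : I 1 by exact: lin3_1.
have Iz : I zeta by exact: lin3_2.
have Iy : I z by exact: lin3_3.
have IW : ksubset I W.
  by apply: lin3_sub; [exact: submod_le DW (submod_self hW)|sr|sr|sr].
have IM := fractional_ring hI (lin3_fractional hD hq _ _ _) I1 IW.
have hI' : subring I by split=> // x y; exact: (smB hI).
have DI : ksubset D I by move=> d Dd; rewrite -[d]mulr1; exact: (smZ hI).
have mID x y : mI x -> mI y -> mI (x + y).
  move=> [a [b [c [? ? ? ->]]]] [a' [b' [c' [? ? ? ->]]]].
  by exists (a + a'), (b + b'), (c + c'); split; [exact: hloc|exact: hloc|exact: hloc|ring].
have mIm a v : m a -> I v -> mI (a * v).
  move=> ma [x [y [t [Dx Dy Dt ->]]]].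
  by exists (a * x), (a * y), (a * t); split; [exact: nonunitMr|exact: nonunitMr|exact: nonunitMr|ring].
have mIM x v : I v -> mI x -> mI (v * x).
  move=> Iv [a [b [c [? ? ? ->]]]].
  have -> : v * (a * 1 + b * zeta + c * z) = a * v + b * (v * zeta) + c * (v * z) by ring.
  by apply: (mID); [apply: (mID)|]; apply: (mIm) => //; sr.
have mIN x : mI x -> mI (- x) by move=> mx; rewrite -mulN1r; apply: (mIM) => //; sr.
have ind3 r t : D r -> D t -> mI (z + r + t * zeta) -> False.
  move=> Dr Dt [a [b [c [ma mb mc e]]]]; apply: nz.
  have [_ u0 Du] := runit_1B mc; have Da := nonunit_in ma; have Db := nonunit_in mb.
  exists ((a - r) * (1 - c)^-1), ((b - t) * (1 - c)^-1); split; [sr|sr|].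
  apply: (mulfI u0).
  have -> : (1 - c) * z = z + r + t * zeta - (c * z + r + t * zeta) by ring.
  by rewrite e; field.
(* For a unit c, eta itself would be in mI; solving for eta puts it into m + mz, and [split_in_D]
   then makes it an element of D. *)
have ind c eta : eta = zeta \/ eta = 1 - zeta -> D c -> mI (c * eta) -> m c.
  move=> heta Dc mce; have [[_ c0 Dc']|//] := unit_or_nonunit Dc; exfalso.
  have {mce} : mI eta by rewrite -(mulKf c0 eta); apply: (mIM) => //; sr.
  move=> [a [b [c' [ma mb mc e]]]].
  case: heta => he; rewrite he in e.
    have [_ u0 Du] := runit_1B mb.
    apply: nD; apply: (@split_in_D z (a * (1 - b)^-1) (c' * (1 - b)^-1) zeta mu) => //; try exact: nonunitMr.
    apply: (mulfI u0); have -> : (1 - b) * zeta = zeta - b * zeta by ring.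
    by rewrite {1}e; field.
  have [_ u0 Du] := runit_1B (nonunitN mb).
  have : D (1 - zeta).
    apply: (@split_in_D z ((a + b) * (1 - - b)^-1) (c' * (1 - - b)^-1) _ mu) => //.
    - by apply: nonunitMr => //; exact: hloc.
    - exact: nonunitMr.
    - apply: (mulfI u0); have -> : (1 - - b) * (1 - zeta) = 1 - zeta + b * (1 - zeta) by ring.
      by rewrite {1}e; field; move: u0; rewrite opprK.
    - by have -> : (1 - zeta) ^+ 2 = 1 - zeta - zeta + zeta ^+ 2 by [ring]; rewrite ezeta; ring.
  by move=> h; apply: nD; have -> : zeta = 1 - (1 - zeta) by [ring]; sr.
(* Clearing denominators in the equation of z + eta/(1-eta) puts (1-eta)(a + bz + cz^2) + c eta into
   mI. Multiplying by eta isolates c eta, so c is a nonunit. Then b is a unit, since otherwise a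
   would be a nonunit as well. *)
have step eta : eta = zeta \/ eta = 1 - zeta -> exists2 a, D a & mI ((1 - eta) * (z + a)).
  move=> heta.
  have eeta : eta ^+ 2 = eta + mu.
    case: heta => -> //; have -> : (1 - zeta) ^+ 2 = 1 - zeta - zeta + zeta ^+ 2 by ring.
    by rewrite ezeta; ring.
  have heta' : 1 - eta = zeta \/ 1 - eta = 1 - zeta.
    by case: heta => ->; [right | left; ring].
  have Ie : I eta by case: heta => ->; sr.
  have p0 : 1 - eta != 0.
    by apply: contra_notN nD; rewrite subr_eq0 => /eqP e; case: heta => he;
      [rewrite -he -e|have -> : zeta = 1 - (1 - zeta) by [ring]; rewrite -he -e]; sr.
  have [a [b [c [Da Db Dc e h]]]] := primitive_quadratic (z + eta / (1 - eta)).
  pose X := a + b * z - b + c * z ^+ 2 - c * z *+ 2 + c.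
  have {}e : a * (1 - eta) + b * ((1 - eta) * z) + c * ((1 - eta) * z ^+ 2 + eta) = - mu * X.
    have emu : mu = eta ^+ 2 - eta by rewrite eeta; ring.
    apply/eqP; rewrite -subr_eq0 -(mulr0 ((1 - eta) ^+ 2)) -e /X emu; apply/eqP.
    by field.
  have IX : I X by rewrite /X; sr.
  have mX : mI (- mu * X) by apply: (mIm) => //; exact: nonunitN.
  have mc : m c.
    apply: (ind c eta) => //.
    have -> : c * eta = eta * (- mu * X) + mu * (a + b * z + c * z ^+ 2 - c).
      rewrite -e; have -> : mu = eta ^+ 2 - eta by rewrite eeta; ring.
      by ring.
    by apply: (mID); [exact: mIM | apply: (mIm) => //; sr].
  have mab : mI (a * (1 - eta) + b * ((1 - eta) * z)).
    have -> : a * (1 - eta) + b * ((1 - eta) * z) = - mu * X + - c * ((1 - eta) * z ^+ 2 + eta).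
      by rewrite -e; ring.
    by apply: (mID) => //; apply: (mIm); [exact: nonunitN | sr].
  have [[_ b0 Db']|mb] := unit_or_nonunit Db.
    exists (a * b^-1); first sr.
    have -> : (1 - eta) * (z + a * b^-1) = b^-1 * (a * (1 - eta) + b * ((1 - eta) * z)) by field.
    by apply: (mIM) => //; sr.
  have ma : m a.
    apply: (ind a (1 - eta)) => //.
    have -> : a * (1 - eta) = a * (1 - eta) + b * ((1 - eta) * z) + - b * ((1 - eta) * z) by ring.
    by apply: (mID) => //; apply: (mIm); [exact: nonunitN | sr].
  by case: h => u; [case: ma|case: mb|case: mc].
have [a Da h1] := step zeta (or_introl erefl).
have [b Db h2] := step (1 - zeta) (or_intror erefl).
apply: (ind3 a (b - a)) => //; first sr.
have -> : z + a + (b - a) * zeta = (1 - zeta) * (z + a) + (1 - (1 - zeta)) * (z + b) by ring.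
exact: mID.
Qed.
(** Dividing zeta by the unit l makes it idempotent modulo [m], so [W] lies in D + D (zeta/l). *)
Lemma split_fractional zeta l mu : W zeta -> ~ D zeta -> runit D l -> m mu ->
  zeta ^+ 2 = l * zeta + mu -> fractional D W.
Proof.
move=> Wz nD [Dl l0 Dl'] mmu e.
have W1 : W (zeta / l) by sr.
have nD1 : ~ D (zeta / l).
  by move=> h; apply: nD; have -> : zeta = zeta / l * l by [field]; sr.
have mu1 : m (mu / l ^+ 2) by apply: nonunitMr => //; rewrite -exprVn; sr.
have e1 : (zeta / l) ^+ 2 = zeta / l + mu / l ^+ 2 by rewrite expr_div_n e; field.
have [d [d0 hd]] := lin3_fractional hD hq 1 (zeta / l) 0.
exists d; split=> // z Wz'; apply: hd.
have [a [b [Da Db ->]]] := split_generates W1 nD1 mu1 e1 Wz'.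
by exists a, b, 0; split; [sr|sr|sr|ring].
Qed.

Lemma bezout_W y z : z != 0 -> exists u p q a b,
  [/\ W p, W q, W a & W b] /\ [/\ u != 0, y = u * p, z = u * q & a * p + b * q = 1].
Proof.
move=> z0; have [u [hu [p [q [Wp Wq ey ez]]]]] := gcd_W y z.
have u0 : u != 0 by apply: contraNneq z0 => u0; rewrite ez u0 mul0r.
case: hu => eu.
- exists u, p, q, 1, 0; split; split=> //; [sr|sr|].
  by apply: (mulfI u0); rewrite mul1r mul0r addr0 -ey eu mulr1.
- exists u, p, q, 0, 1; split; split=> //; [sr|sr|].
  by apply: (mulfI u0); rewrite mul1r mul0r add0r -ez eu mulr1.
- exists u, p, q, 1, 1; split; split=> //; [sr|sr|].
  by apply: (mulfI u0); rewrite !mul1r mulrDr -ey -ez eu mulr1.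
Qed.

(** * Ideals of an overring of the local domain *)

Section Ideal.
Variables T J : K -> Prop.
Hypothesis hT : subring T.
Hypothesis DT : ksubset D T.
Hypothesis hJ : submod T J.
Hypothesis nJ : nonzero J.
Hypothesis JT : ksubset J T.

Lemma meets_D : exists c, [/\ J c, D c & c != 0].
Proof.
have [x [Jx x0]] := nJ; have [a [b [Da Db b0 ex]]] := hq x.
exists a; split=> //.
  by have -> : a = b * x by [rewrite ex; field]; apply: (smZ hJ) => //; exact: DT.
by apply: contraNneq x0 => a0; rewrite ex a0 mul0r.
Qed.

Lemma prin_extend (I : K -> Prop) :
  prin I -> ksubset I J -> ksubset J (modprod I T) -> prin J.
Proof.
move=> [w [Iw w0 hw]] IJ JI; exists w; split=> //; first exact: IJ.
move=> y z /JI + /JI hz; move: y; apply: modprod_ind => [|y y' hy hy'|a t Ia Tt].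
- by rewrite !mul0r; exact: sm0 hJ.
- by rewrite !mulrDl; exact: (smD hJ).
move: z hz; apply: modprod_ind => [|z z' hz hz'|b s Ib Ts].
- by rewrite mulr0 mul0r; exact: sm0 hJ.
- by rewrite mulrDr mulrDl; exact: (smD hJ).
have -> : a * t * (b * s) / w = t * s * (a * b / w) by ring.
by apply: (smZ hJ); [sr | apply/IJ/hw].
Qed.

Lemma prin_of_fractional_closure : fractional D W -> prin J.
Proof.
move=> [d [d0 hd]].
have Dd : D d by rewrite -[d]mulr1; apply: hd; sr.
pose I x := J x /\ D (d ^+ 2 * x).
have hI : submod D I.
  split=> [|x y [Jx Dx] [Jy Dy]|r x Dr [Jx Dx]].
  - by split; [exact: sm0 hJ | rewrite mulr0; sr].
  - by split; [exact: (smD hJ) | rewrite mulrDr; sr].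
  - by split; [apply: (smZ hJ) => //; exact: DT | rewrite mulrCA; sr].
have [c [Jc Dc c0]] := meets_D.
have nI : nonzero I by exists c; split=> //; split=> //; sr.
have fI : fractional D I by exists (d ^+ 2); split=> [|x []//]; rewrite expf_neq0.
apply: (prin_extend (fractional_prin hI nI fI)) => [x []//|x Jx].
have [p [q [_ _ q0 ex]]] := hq x.
have [v [w [s [a [b [[Ww Ws Wa Wb] [v0 ep eq eab]]]]]]] := bezout_W p q0.
have s0 : s != 0 by apply: contraNneq q0 => s0; rewrite eq s0 mulr0.
have {ep eq p q q0} ex : x = w / s by rewrite ex ep eq; field; rewrite v0 s0.
have [u [s' [d' [a' [b' [[Ws' Wd' Wa' Wb'] [u0 es ed eab']]]]]]] := bezout_W s d0.
have Id z : W z -> I (d * (w * z)).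
  move=> Wz; split; last by have := hd _ (srM hW Ww Wz) => ?; sr.
  have -> : d * (w * z) = d * (z * s) * x by rewrite ex; field.
  by apply: (smZ hJ) => //; apply/DT/hd; sr.
(* Here x = w/s with a w + b s = 1, and u is a gcd of s and d. The element y is d w b' s' (a x +
   b)^2 = d w b' s' / s^2, expanded with x^2, x and 1 as coefficients from T. What remains, x - y =
   w a'/u, has a denominator dividing d. *)
pose y := d * (w * (b' * s' * a ^+ 2)) * (x * x) + d * (w * (b' * s' * (a * b *+ 2))) * x
  + d * (w * (b' * s' * b ^+ 2)) * 1.
have hy : modprod I T y.
  by have Tx := JT Jx; apply: modprodD; [apply: modprodD|]; apply: modprodM; [apply: Id; sr|sr|apply: Id; sr|sr|apply: Id; sr|sr].
have Jy : J y.
  by move: hy; apply: modprod_ind => [|? ? ? ?|i t [Ji _] Tt];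
    [exact: sm0 hJ | exact: (smD hJ) | exact: (smZr hJ)].
have s'0 : s' != 0 by apply: contraNneq s0 => h; rewrite es h mulr0.
have e0 : x - y = w * a' / u.
  have -> : y = d * w * b' * s' * (a * x + b) ^+ 2 by rewrite /y; ring.
  have -> : a * x + b = s^-1.
    by apply: (mulfI s0); rewrite divff // -eab ex; field.
  have -> : x = w / s * (a' * s' + b' * d') by rewrite eab' mulr1.
  by rewrite {1}ed es; field; rewrite u0 s'0.
have -> : x = (x - y) * 1 + y by ring.
apply: modprodD => //; apply: modprodM; last sr.
split; first exact: (smB hJ).
rewrite e0; have -> : d ^+ 2 * (w * a' / u) = d * (w * a' * d') by rewrite expr2 -mulrA {2}ed; field.
by apply: hd; sr.
Qed.

(** For y, z in J write Dx + Dy + Dz = w S with S a ring. Then x/w is in S and its inverse is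
    integral over T, so w/x is in ST, and yz/x is in w S T, a subset of J. *)
Lemma prin_of_integral_generator x : J x -> x != 0 ->
  (forall y, J y -> intg T (y / x)) -> prin J.
Proof.
move=> Jx x0 hx; exists x; split=> // y z Jy Jz.
pose I := lin3 D x y z.
have hI : submod D I by exact: lin3_submod.
have Ix : I x by exact: lin3_1.
have IJ : ksubset I J by apply: lin3_sub => //; exact: submod_le DT hJ.
have [|w [Iw w0 hw]] := fractional_prin hI _ (lin3_fractional hD hq x y z); first by exists x.
have hS := prin_subring hI Iw w0 hw.
set S := fun x => I (w * x) in hS.
have hST := subring_modprod hS hT.
have TST : ksubset T (modprod S T).
  by move=> t Tt; rewrite -[t]mul1r; apply: modprodM => //; exact: sr1 hS.
have SST t : S t -> modprod S T t.
  by move=> St; rewrite -[t]mulr1; apply: modprodM => //; exact: sr1 hT.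
have IS t : I t -> S (t / w) by move=> It; rewrite /S; have -> : w * (t / w) = t by field.
have Sx : modprod S T (w / x).
  have -> : w / x = (x / w)^-1 by rewrite invf_div.
  apply: (intg_inv hST); first exact/SST/IS.
    by rewrite mulf_neq0 ?invr_eq0.
  by rewrite invf_div; apply: (intg_le TST); apply/hx/IJ.
have -> : y * z / x = w * (y / w * (z / w) * (w / x)) by field; rewrite x0 w0.
have : modprod S T (y / w * (z / w) * (w / x)).
  by apply: (srM hST) => //; apply/SST/(srM hS); apply: IS; [exact: lin3_2 | exact: lin3_3].
move: (y / w * _ * _); apply: modprod_ind => [|p q hp hq'|s t Ss Tt].
- by rewrite mulr0; exact: sm0 hJ.
- by rewrite mulrDr; exact: (smD hJ).
- by rewrite mulrA; apply: (smZr hJ) => //; exact: IJ.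
Qed.

Hypothesis nfW : ~ fractional D W.

(** In the third case of the trichotomy t = 1/(1+z) is in D, as otherwise [split_fractional]
    applies. Then t or 1 - t is a unit of D, which puts z or 1/z into [W]. *)
Lemma W_or_inv z : W z \/ z != 0 /\ W z^-1.
Proof.
case: (quadratic_trichotomy z) => [/quad_W|[z0 /quad_W]|[t0 [l [mu [ul mmu e]]]]]; [by left|by right|].
have [Dt|nDt] := pselect (D (1 + z)^-1); last first.
  by case: nfW; apply: (split_fractional _ nDt ul mmu e); apply: (intg_quad hD _ _ e); [case: ul|case: mmu].
have [[_ _ Dt']|mt] := unit_or_nonunit Dt.
  by left; have -> : z = (1 + z)^-1^-1 - 1 by [rewrite invrK; ring]; sr.
have [_ u0 Du] := runit_1B mt.
have z0 : z != 0.
  by apply: contraNneq u0 => ->; rewrite addr0 invr1 subrr.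
right; split=> //.
have -> : z^-1 = (1 + z)^-1 * (1 - (1 + z)^-1)^-1.
  have e1 : 1 - (1 + z)^-1 = z / (1 + z) by field.
  by rewrite e1; field; rewrite z0 t0.
sr.
Qed.

(** A unit constant term would invert p in [W]. A unit linear coefficient would make [W] fractional
    unless p is in D, and then l = p, n = 0 will do. *)
Lemma W_nonunit p : W p -> p != 0 -> ~ W p^-1 ->
  exists l n, [/\ m l, m n & p ^+ 2 = l * p + n].
Proof.
move=> Wp p0 nWp; have [l [n [Dl Dn e]]] := W_quad Wp.
have [[_ n0 Dn']|mn] := unit_or_nonunit Dn.
  case: nWp; have -> : p^-1 = (p - l) * n^-1; last by sr.
  have en : n = p * (p - l) by rewrite mulrBr -expr2 e; ring.
  have pl : p - l != 0 by apply: contraNneq n0 => h; rewrite en h mulr0.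
  by rewrite en; field; rewrite p0 pl.
have [ul|ml] := unit_or_nonunit Dl; last by exists l, n.
have [Dp|nDp] := pselect (D p); last by case: nfW; exact: split_fractional e.
have [[_ _ /DW //]|mp] := unit_or_nonunit Dp.
by exists p, 0; split=> //; [exact: nonunit0 | rewrite addr0 expr2].
Qed.

(** In the valuation ring [W], one of the coefficients l, n of p^2 = l p + n divides the other; it
    is taken as s. *)
Lemma W_nonunit_sq p : W p -> p != 0 -> ~ W p^-1 ->
  exists s, [/\ m s, s != 0 & W (p ^+ 2 / s)].
Proof.
move=> Wp p0 nWp; have [l [n [ml mn e]]] := W_nonunit Wp p0 nWp.
have Dl := nonunit_in ml; have Dn := nonunit_in mn.
have p20 : p ^+ 2 != 0 by rewrite expf_neq0.
have [l0|l0] := eqVneq l 0.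
  exists n; split=> //; first by apply: contraNneq p20 => n0; rewrite e l0 n0 mul0r addr0.
  have n0 : n != 0 by apply: contraNneq p20 => n0; rewrite e l0 n0 mul0r addr0.
  by rewrite e l0 mul0r add0r divff //; sr.
have [n0|n0] := eqVneq n 0.
  exists l; split=> //; rewrite e n0 addr0; have -> : l * p / l = p by field.
  by [].
have [h|[_ h]] := W_or_inv (l / n).
  exists n; split=> //; rewrite e; have -> : (l * p + n) / n = l / n * p + 1 by field.
  sr.
exists l; split=> //; rewrite e; have -> : (l * p + n) / l = p + (l / n)^-1 by field; rewrite l0 n0.
sr.
Qed.

Lemma not_divisible s c : m s -> s != 0 -> D c -> c != 0 -> exists j, ~ W (c / s ^+ j).
Proof.
move=> ms s0 Dc c0; apply: contrapT => h; apply: nfW.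
apply: (W_fractional_of_divisible ms s0 Dc c0) => j; apply: contrapT => hj.
by apply: h; exists j.
Qed.

(** Take a in [m] with m^2 inside a m. If y/a is outside [W], then a (y/a)^k stays in [m] for all k,
    while some s in [m] divides (a/y)^2. So every power of s divides a in [W], against
    [not_divisible]. *)
Lemma nonunits_principal : exists a, [/\ m a, a != 0 & forall y, m y -> W (y / a)].
Proof.
have nm : nonzero m.
  apply: contrapT => hm; apply: nfW; exists 1; split=> [|z _]; first exact: oner_neq0.
  rewrite mul1r; have [a [b [Da Db b0 ->]]] := hq z.
  have [[_ _ Db']|mb] := unit_or_nonunit Db; first sr.
  by case: hm; exists b.
have fm : fractional D m by exists 1; split=> [|z [Dz _]]; rewrite ?oner_neq0 ?mul1r.
have [a [ma a0 ha]] := fractional_prin nonunit_submod nm fm.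
exists a; split=> // y my; apply: contrapT => nW.
have [//|[z0 Wp]] := W_or_inv (y / a).
have nWp : ~ W (y / a)^-1^-1 by rewrite invrK.
have [s [ms s0 hs]] := W_nonunit_sq Wp (invr_neq0 z0) nWp.
have ha' k : m (a * (y / a) ^+ k).
  elim: k => [|k IH]; first by rewrite mulr1.
  have -> : a * (y / a) ^+ k.+1 = y * (a * (y / a) ^+ k) / a by rewrite exprS; ring.
  exact: ha.
have [j []] := not_divisible ms s0 (nonunit_in ma) a0.
have -> : a / s ^+ j = a * (y / a) ^+ (2 * j) * ((y / a)^-1 ^+ 2 / s) ^+ j.
  move: (y / a) z0 => z z0; rewrite exprM expr_div_n !exprVn.
  have := expf_neq0 j (expf_neq0 2 z0); have := expf_neq0 j s0.
  set Z := (z ^+ 2) ^+ j; set S := s ^+ j => S0 Z0; field.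
  by rewrite Z0 S0.
by have /nonunit_in ? := ha' (2 * j)%N; sr.
Qed.

Lemma prin_of_nonfractional_closure : prin J.
Proof.
have hiT := intg_subring hT.
have WiT : ksubset W (intg T) := intg_le DT.
have [c [Jc Dc c0]] := meets_D.
(* If an element outside [W] is integral over T, so is 1/s for some s in [m]. Then all of K is
   integral over T, since for each b some s^j/b is in [W], and any nonzero element of J serves. *)
have [[t iTt nWt]|sTW] := pselect (exists2 t, intg T t & ~ W t).
  have [//|[t0 Wp]] := W_or_inv t.
  have nWp : ~ W t^-1^-1 by rewrite invrK.
  have [s [ms s0 hs]] := W_nonunit_sq Wp (invr_neq0 t0) nWp.
  have iTs : intg T s^-1.
    have -> : s^-1 = t^-1 ^+ 2 / s * t ^+ 2 by field; rewrite t0 s0.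
    by apply: (srM hiT); [exact: WiT | sr].
  apply: (prin_of_integral_generator Jc c0) => y _.
  have [a [b [Da Db b0 ->]]] := hq (y / c).
  have [j nj] := not_divisible ms s0 Db b0.
  have [//|[bs0 Wb]] := W_or_inv (b / s ^+ j).
  have -> : a / b = a * (b / s ^+ j)^-1 * s^-1 ^+ j by rewrite exprVn; field; rewrite b0 expf_neq0.
  have iTa : intg T a by apply/(intg_in hT)/DT.
  have := WiT _ Wb => ?; sr.
have TW t : T t -> W t.
  by move=> Tt; apply: contrapT => nW; apply: sTW; exists t => //; exact: intg_in.
apply: contrapT => np.
have next x : J x -> x != 0 -> exists y, [/\ J y, y != 0, W (x / y) & ~ W (y / x)].
  move=> Jx x0; apply: contrapT => h; apply: np.
  apply: (prin_of_integral_generator Jx x0) => y Jy; apply/WiT.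
  apply: contrapT => nW; apply: h; exists y.
  have [//|[yx0]] := W_or_inv (y / x); rewrite invf_div => Wxy.
  by split=> //; apply: contra_not_neq nW => ->; rewrite mul0r; sr.
have [a [ma a0 ha]] := nonunits_principal.
have sq p : W p -> p != 0 -> ~ W p^-1 -> W (p ^+ 2 / a).
  move=> Wp p0 nWp; have [l [n [ml mn ->]]] := W_nonunit Wp p0 nWp.
  have -> : (l * p + n) / a = l / a * p + n / a by ring.
  by have := ha _ ml; have := ha _ mn => ? ?; sr.
(* Two descents in value gain a factor a: the product of the nonunits x/y and y/z is a [W]-multiple
   of the square of one of them, and a divides both squares. *)
have next2 x : J x -> x != 0 -> exists y, [/\ J y, y != 0 & W (x / (a * y))].
  move=> Jx x0; have [y [Jy y0 W1 nW1]] := next x Jx x0.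
  have [z [Jz z0 W2 nW2]] := next y Jy y0.
  have n1 : ~ W (x / y)^-1 by rewrite invf_div.
  have n2 : ~ W (y / z)^-1 by rewrite invf_div.
  have p0 : x / y != 0 by rewrite mulf_neq0 ?invr_eq0.
  have q0 : y / z != 0 by rewrite mulf_neq0 ?invr_eq0.
  have s1 := sq _ W1 p0 n1; have s2 := sq _ W2 q0 n2.
  exists z; split=> //.
  have [h|[_ h]] := W_or_inv ((x / y) / (y / z)).
    have -> : x / (a * z) = (y / z) ^+ 2 / a * ((x / y) / (y / z)) by field; rewrite ?y0 ?z0 ?a0.
    sr.
  have -> : x / (a * z) = (x / y) ^+ 2 / a * ((x / y) / (y / z))^-1 by field; rewrite ?y0 ?z0 ?a0 ?x0.
  sr.
have [j []] := not_divisible ma a0 Dc c0.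
suff [y [Jy y0 Wy]] : exists y, [/\ J y, y != 0 & W (c / (a ^+ j * y))].
  have -> : c / a ^+ j = c / (a ^+ j * y) * y by field; rewrite y0 expf_neq0.
  by have := TW _ (JT Jy) => ?; sr.
elim: j => [|j [y [Jy y0 Wy]]].
  by exists c; split=> //; rewrite mul1r divff //; sr.
have [z [Jz z0 Wz]] := next2 y Jy y0; exists z; split=> //.
have -> : c / (a ^+ j.+1 * z) = c / (a ^+ j * y) * (y / (a * z)).
  by rewrite exprS; field; rewrite y0 z0 a0 expf_neq0.
sr.
Qed.

End Ideal.

Theorem overring_ideal_prin (T J : K -> Prop) : subring T -> ksubset D T ->
  submod T J -> nonzero J -> ksubset J T -> prin J.
Proof.
move=> hT DT hJ nJ JT; have [fW|nfW] := pselect (fractional D W).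
  exact: (prin_of_fractional_closure hT DT hJ nJ JT).
exact: (prin_of_nonfractional_closure hT DT hJ nJ JT).
Qed.
End Local.

(** * Maximal t-ideals and localization *)

Section TIdeals.
Variables (K : fieldType) (R : K -> Prop).
Hypothesis hR : subring R.

Lemma span_in (s : seq K) x : x \in s -> span R s x.
Proof.
move=> xs; exists (fun i => if i == index x s then 1 else 0); split=> [i|].
  by case: ifP => _; sr.
have h : (index x s < size s)%N by rewrite index_mem.
rewrite (bigD1 (Ordinal h)) //= eqxx nth_index // mul1r big1 ?addr0 // => i.
by rewrite -val_eqE /= => /negPf ->; rewrite mul0r.
Qed.

Lemma span_sub (A : K -> Prop) (s : seq K) : submod R A ->
  (forall x, x \in s -> A x) -> ksubset (span R s) A.
Proof.
move=> hA hs _ [r [Dr ->]]; elim/big_ind: _ => [|x y|i _]; [exact: sm0 hA|exact: (smD hA)|].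
by apply: (smZ hA) => //; apply/hs/mem_nth.
Qed.

(* [vseq s x]: [x] belongs to the divisorial closure of the ideal generated by [s]. *)
Definition vseq (s : seq K) (x : K) :=
  forall u, (forall y, y \in s -> R (u * y)) -> R (x * u).

Lemma vop_span s x : vop R (span R s) x <-> vseq s x.
Proof.
split=> h u hu; apply: h => y hy; last by apply/hu/span_in.
have hA : submod R (fun y => R (u * y)).
  by split=> [|a b ? ?|r a ? ?]; [rewrite mulr0 | rewrite mulrDr | rewrite mulrCA]; sr.
exact: (span_sub hA hu).
Qed.

Lemma topP A x : submod R A -> top R A x <->
  exists s : seq K, [/\ forall y, y \in s -> A y, exists2 y, y \in s & y != 0 & vseq s x].
Proof.
move=> hA; split=> [[J [[s /seteq_eq eJ] [y [Jy y0]] JA hx]]|[s [sA [y ys y0] hx]]].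
  rewrite {}eJ in Jy JA hx *; exists s; split; [|apply: contrapT => h|exact/vop_span].
    by move=> z zs; apply/JA/span_in.
  move/eqP: y0; apply; have h0 : submod R (fun z => z = 0).
    by split=> [|? ? -> ->|? ? _ ->]; rewrite ?addr0 ?mulr0.
  apply: (span_sub h0 _ Jy) => z zs; have [//|z0] := eqVneq z 0.
  by case: h; exists z.
exists (span R s); split; [by exists s|by exists y; split=> //; exact: span_in| |exact/vop_span].
exact: span_sub.
Qed.

Lemma t_ideal_vseq M s x : t_ideal R M -> (forall y, y \in s -> M y) ->
  (exists2 y, y \in s & y != 0) -> vseq s x -> M x.
Proof.
by move=> [[hM _] _ eM] sM s0 hx; apply/eM/topP => //; exists s.
Qed.

Lemma t_idealP M : ideal R M -> nonzero M ->
  (forall s x, (forall y, y \in s -> M y) -> (exists2 y, y \in s & y != 0) -> vseq s x -> M x) ->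
  t_ideal R M.
Proof.
move=> [hM MR] [z [Mz z0]] h; split=> //; first by exists z.
move=> x; split=> [Mx|/(topP _ hM) [s []]]; last exact: h.
apply/topP => //; have [->|x0] := eqVneq x 0.
  exists [:: z]; split=> [y|| u _]; [by rewrite inE => /eqP ->| |by rewrite mul0r; sr].
  by exists z; rewrite ?inE.
exists [:: x]; split=> [y|| u hu]; [by rewrite inE => /eqP ->| |].
  by exists x; rewrite ?inE.
by rewrite mulrC; apply: hu; rewrite inE.
Qed.

(** For idempotence, finitely many elements of A_t lie in the divisorial closure of one common
    finite list from A. *)
Lemma top_t_ideal A : ideal R A -> nonzero A -> t_ideal R (top R A) /\ ksubset A (top R A).
Proof.
move=> [hA AR] [a [Aa a0]].
have AT : ksubset A (top R A).
  move=> x Ax; apply/topP => //; exists [:: a; x]; split=> [y|| u hu].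
  - by rewrite !inE => /orP [] /eqP ->.
  - by exists a; rewrite ?inE ?eqxx.
  - by rewrite mulrC; apply: hu; rewrite !inE eqxx orbT.
split=> //; apply: t_idealP; [split| |].
- split=> [|x y /(topP _ hA) [s [sA s0 hx]] /(topP _ hA) [t [tA t0 hy]]|r x Rr /(topP _ hA) [s [sA s0 hx]]].
  + exact/AT/(sm0 hA).
  + apply/topP => //; exists (s ++ t); split.
    * by move=> z; rewrite mem_cat => /orP [/sA|/tA].
    * by have [z zs z0] := s0; exists z; rewrite // mem_cat zs.
    move=> u hu; rewrite mulrDl; apply: (srD hR); [apply: hx|apply: hy] => z zs; apply: hu;
    by rewrite mem_cat zs ?orbT.
  + apply/topP => //; exists s; split=> // u hu; have := hx u hu => ?.
    by rewrite -mulrA; sr.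
- move=> x /(topP _ hA) [s [sA s0 hx]]; rewrite -[x]mulr1; apply: hx => y ys.
  by rewrite mul1r; apply/AR/sA.
- by exists a; split=> //; exact: AT.
move=> s x sT s0 hx.
have [t [tA t0 ht]] : exists t : seq K, [/\ forall y, y \in t -> A y,
    exists2 y, y \in t & y != 0 & forall y, y \in s -> vseq t y].
  elim: s {s0 hx} sT => [|z s IH] sT.
    by exists [:: a]; split=> // [y|]; [rewrite inE => /eqP -> | exists a; rewrite ?inE].
  have [t [tA t0 ht]] : exists t : seq K, [/\ forall y, y \in t -> A y,
    exists2 y, y \in t & y != 0 & forall y, y \in s -> vseq t y].
    by apply: IH => y ys; apply: sT; rewrite in_cons ys orbT.
  have /(topP _ hA) [t' [tA' _ ht']] := sT z (mem_head _ _).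
  exists (t ++ t'); split.
  - by move=> y; rewrite mem_cat => /orP [/tA|/tA'].
  - by have [y yt y0] := t0; exists y; rewrite // mem_cat yt.
  move=> y; rewrite in_cons => /orP [/eqP ->|ys] u hu; [apply: ht'|apply: (ht _ ys)] => v vt;
  by apply: hu; rewrite mem_cat vt ?orbT.
apply/topP => //; exists t; split=> // u hu; apply: hx => y ys; rewrite mulrC.
exact: ht.
Qed.

Lemma tmax_exists A : ideal R A -> nonzero A -> ~ top R A 1 ->
  exists2 M, tmax R M & ksubset A M.
Proof.
move=> iA nA nA1; have [tA AT] := top_t_ideal iA nA.
pose P (X : set K) := X = set0 \/ [/\ t_ideal R X, ~ X 1 & ksubset A X].
have [X [PX maxX]] : exists X, P X /\ forall B, (X `<` B)%classic -> ~ P B.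
  apply: Zorn_bigcup => F FP tot.
  have [F0|] := pselect (forall X, F X -> X = set0).
    by left; apply/seteqP; split=> // x [X /F0 ->].
  move=> /existsNP [X0 /not_implyP [FX0 X0n]].
  have {X0n} [tX0 X01 AX0] : [/\ t_ideal R X0, ~ X0 1 & ksubset A X0] by case: (FP _ FX0).
  have FPx X x : F X -> X x -> [/\ t_ideal R X, ~ X 1 & ksubset A X].
    by move=> /FP [->|].
  right; split.
  (* A finite list in the union lies in one member of the chain; this is why the union is again a
     t-ideal. *)
  - have one (s : seq K) : (forall y, y \in s -> (\bigcup_(X in F) X)%classic y) ->
        exists X, [/\ F X, t_ideal R X & forall y, y \in s -> X y].
      elim: s => [|z s IH] hs; first by exists X0.
      have [X [FX tX sX]] : exists X, [/\ F X, t_ideal R X & forall y, y \in s -> X y].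
        by apply: IH => y ys; apply: hs; rewrite in_cons ys orbT.
      have [Y FY Yz] := hs z (mem_head _ _).
      have [tY _ _] := FPx _ _ FY Yz.
      have [XY|YX] := tot _ _ FX FY.
        exists Y; split=> // y; rewrite in_cons => /orP [/eqP -> //|/sX]; exact: XY.
      exists X; split=> // y; rewrite in_cons => /orP [/eqP ->|/sX //]; exact: YX.
    apply: t_idealP; [split; [split|]| |].
    + by exists X0 => //; case: tX0 => [[hX _] _ _]; exact: sm0 hX.
    + move=> x y hx hy; have [|X [FX [[hX _] _ _] sX]] := one [:: x; y].
        by move=> z; rewrite !inE => /orP [] /eqP ->.
      by exists X => //; apply: (smD hX); apply: sX; rewrite !inE eqxx ?orbT.
    + move=> r x Rr [X FX Xx]; have [[[hX _] _ _] _ _] := FPx _ _ FX Xx.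
      by exists X => //; apply: (smZ hX).
    + by move=> x [X FX Xx]; have [[[_ XR] _ _] _ _] := FPx _ _ FX Xx; exact: XR.
    + by have [z [Az z0]] := nA; exists z; split=> //; exists X0 => //; exact: AX0.
    + move=> s x /one [X [FX tX sX]] s0 hx; exists X => //.
      exact: t_ideal_vseq tX sX s0 hx.
  - by move=> [X FX X1]; have [_ /(_ X1)] := FPx _ _ FX X1.
  - by move=> x Ax; exists X0 => //; exact: AX0.
have PA : P (top R A) by right.
have [X0|[tX X1 AX]] := PX.
  case: (maxX _ _ PA); rewrite X0; split=> [x []|h].
  by have [z [Az _]] := nA; exact: (h z (AT z Az)).
exists X => //; split=> //; first by exists 1; split=> //; sr.
move=> N tN [y [Ry nNy]] XN; have PN : P N.
  right; split=> // [N1|x /AX /XN //]; apply: nNy; case: tN => [[hN _] _ _].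
  by rewrite -[y]mulr1; apply: (smZ hN).
have [NX|/existsNP [x /not_implyP [Nx nXx]]] := pselect (ksubset N X).
  by move=> x; split=> [/NX|/XN].
by case: (maxX _ _ PN); split=> // h; exact/nXx/h.
Qed.

Section TMax.
Variable M : K -> Prop.
Hypothesis hM : tmax R M.

Lemma tmax_submod : submod R M. Proof. by case: hM => [[[]]]. Qed.
Lemma tmax_sub : ksubset M R. Proof. by case: hM => [[[]]]. Qed.
Lemma tmax_n1 : ~ M 1.
Proof.
move=> M1; have [_ [y [Ry nMy]] _] := hM; apply: nMy.
by rewrite -[y]mulr1; apply: (smZ tmax_submod).
Qed.

Lemma tmax_vseq s x : (forall y, y \in s -> M y) -> (exists2 y, y \in s & y != 0) ->
  vseq s x -> M x.
Proof. by case: hM => + _ _; exact: t_ideal_vseq. Qed.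

(** For a outside M, the elements of R that multiply a into M form a proper t-ideal containing M,
    hence M itself. *)
Lemma tmax_prime a b : R a -> R b -> M (a * b) -> M a \/ M b.
Proof.
move=> Ra Rb Mab; have [|nMa] := pselect (M a); [by left|right].
pose N r := R r /\ M (r * a).
have hMs := tmax_submod.
have a0 : a != 0 by apply/eqP => a0; apply: nMa; rewrite a0; exact: sm0 hMs.
have MN : ksubset M N by move=> x Mx; split; [exact: tmax_sub | exact: (smZr hMs)].
have hN : submod R N.
  split=> [|x y [Rx Mx] [Ry My]|r x Rr [Rx Mx]].
  - by split; [sr | rewrite mul0r; exact: sm0 hMs].
  - by split; [sr | rewrite mulrDl; exact: (smD hMs)].
  - by split; [sr | rewrite -mulrA; exact: (smZ hMs)].
have tN : t_ideal R N.
  apply: t_idealP; [by split=> // x []| |].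
    by case: hM => [[_ [z [Mz z0]] _] _ _]; exists z; split=> //; exact: MN.
  move=> s x sN [z zs z0] hx; split.
    rewrite -[x]mulr1; apply: hx => y ys; rewrite mul1r; by case: (sN _ ys).
  apply: (@tmax_vseq [seq y * a | y <- s]).
  - by move=> _ /mapP [y /sN [_ My] ->].
  - by exists (z * a); [exact: map_f | rewrite mulf_neq0].
  move=> u hu; rewrite -mulrA; apply: hx => y ys.
  by rewrite mulrAC -mulrA mulrC -mulrA mulrCA; apply: hu; exact: map_f.
have pN : proper R N by exists 1; split=> [|[_]]; [sr | rewrite mul1r].
case: hM => _ _ /(_ N tN pN MN) e.
by apply/e; split=> //; rewrite mulrC.
Qed.

Lemma tmax_primeC a b : R a -> R b -> ~ M a -> ~ M b -> ~ M (a * b).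
Proof. by move=> Ra Rb na nb /(tmax_prime Ra Rb) []. Qed.

(** A single denominator replaces the sums in E R_M; [modprod_loc] shows that both agree on
    submodules. *)
Definition locm (E : K -> Prop) (x : K) := exists s, [/\ R s, ~ M s & E (s * x)].

Lemma locm_in (E : K -> Prop) x : E x -> locm E x.
Proof. by exists 1; split; [sr|exact: tmax_n1|rewrite mul1r]. Qed.

Lemma locm_submod E : submod R E -> submod R (locm E).
Proof.
move=> hE; split.
- exact/locm_in/(sm0 hE).
- move=> x y [s [Rs ns Ex]] [t [Rt nt Ey]]; exists (s * t); split; [sr|exact: tmax_primeC|].
  have -> : s * t * (x + y) = t * (s * x) + s * (t * y) by ring.
  by apply: (smD hE); apply: (smZ hE).
- by move=> r x Rr [s [Rs ns Ex]]; exists s; split=> //; rewrite mulrCA; apply: (smZ hE).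
Qed.

Lemma locm_cancel E s x : R s -> ~ M s -> locm E (s * x) -> locm E x.
Proof.
move=> Rs ns [t [Rt nt Ex]]; exists (t * s); split; [sr|exact: tmax_primeC|].
by rewrite -mulrA.
Qed.

Lemma locm_idem E F x : (forall y, E y -> locm F y) -> locm E x -> locm F x.
Proof. by move=> EF [s [Rs ns /EF]]; exact: locm_cancel. Qed.

Lemma loc_locm : loc R M = locm R.
Proof.
apply/seteq_eq => x; split=> [[a [s [Ra Rs ns ->]]]|[s [Rs ns Rx]]].
  exists s; split=> //; have s0 : s != 0 by apply/eqP => s0; apply: ns; rewrite s0; exact: sm0 tmax_submod.
  by rewrite mulrC divfK.
have s0 : s != 0 by apply/eqP => s0; apply: ns; rewrite s0; exact: sm0 tmax_submod.
by exists (s * x), s; split=> //; field.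
Qed.

Lemma modprod_loc E : submod R E -> modprod E (loc R M) = locm E.
Proof.
move=> hE; have hL := locm_submod hE; apply/seteq_eq => x; split.
  rewrite loc_locm; move: x; apply: modprod_ind; [exact: sm0 hL|exact: (smD hL)|].
  move=> a b Ea [s [Rs ns Rb]]; exists s; split=> //.
  by rewrite mulrCA; apply: (smZr hE).
move=> [s [Rs ns Ex]].
have s0 : s != 0 by apply/eqP => s0; apply: ns; rewrite s0; exact: sm0 tmax_submod.
have -> : x = s * x * (1 / s) by field.
by apply: modprodM => //; exists 1, s; split=> //; sr.
Qed.

Lemma locm_subring E : ksubset R E -> subring E -> subring (locm E).
Proof.
move=> RE hE; have hL := locm_submod (submod_le RE (submod_self hE)); split.
- by apply: locm_in; sr.
- by move=> x y ? ?; exact: (smB hL).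
- move=> x y [s [Rs ns Ex]] [t [Rt nt Ey]]; exists (s * t); split; [sr|exact: tmax_primeC|].
  by rewrite mulrACA; sr.
Qed.

End TMax.

Lemma unit_vseq A : ideal R A -> nonzero A ->
  (forall M, tmax R M -> exists2 x, A x & ~ M x) ->
  exists s : seq K, [/\ forall y, y \in s -> A y, exists2 y, y \in s & y != 0 & vseq s 1].
Proof.
move=> iA nA h; apply/topP; first by case: iA.
apply: contrapT => /(tmax_exists iA nA) [M hM AM].
by have [x /AM] := h M hM.
Qed.

Lemma vseq_tmax s M : tmax R M -> (exists2 y, y \in s & y != 0) -> vseq s 1 ->
  exists2 y, y \in s & ~ M y.
Proof.
move=> hM s0 hs; apply: contrapT => h; apply: (tmax_n1 hM).
by apply: (tmax_vseq hM _ s0 hs) => y ys; apply: contrapT => My; apply: h; exists y.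
Qed.

Lemma wopP E x : submod R E -> wop R E x <-> forall M, tmax R M -> locm M E x.
Proof.
by move=> hE; split=> h M hM; have := h M hM; rewrite modprod_loc.
Qed.

Hypothesis hq : is_quotient_field R.

(** The ideal of denominators of x escapes every maximal t-ideal, so 1 is in the divisorial closure
    of finitely many of them, and x multiplies these into R. *)
Lemma locally_in x : (forall M, tmax R M -> locm M R x) -> R x.
Proof.
move=> hx; pose A r := R r /\ R (r * x).
have iA : ideal R A.
  split; last by move=> r [].
  split=> [|a b [Ra Rax] [Rb Rbx]|r a Rr [Ra Rax]].
  - by split; rewrite ?mul0r; sr.
  - by split; rewrite ?mulrDl; sr.
  - by split; rewrite -?mulrA; sr.
have nA : nonzero A.
  have [a [b [Ra Rb b0 ex]]] := hq x; exists b; split=> //; split=> //.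
  by have -> : b * x = a by rewrite ex; field.
have [s [sA s0 hs]] : exists s : seq K, [/\ forall y, y \in s -> A y, exists2 y, y \in s & y != 0 & vseq s 1].
  apply: unit_vseq => // M /hx [r [Rr nr Rx]]; by exists r.
by rewrite -[x]mul1r; apply: hs => y /sA [_]; rewrite mulrC.
Qed.

(** Testing elements of R is enough for an ideal, because its w-closure stays in R by
    [locally_in]. *)
Definition wclosed (I : K -> Prop) :=
  forall x, R x -> (forall M, tmax R M -> locm M I x) -> I x.

Lemma wclosed_w_ideal I : ideal R I -> nonzero I -> wclosed I -> w_ideal R I.
Proof.
move=> [hI IR] nI cI; split=> // x; rewrite wopP //; split=> [Ix M hM|h].
  exact: locm_in.
apply: cI => //; apply: locally_in => M hM; apply: (locm_idem hM _ (h M hM)) => y /IR.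
exact: locm_in.
Qed.

Definition wclosure (I : K -> Prop) x := R x /\ forall M, tmax R M -> locm M I x.

Lemma wclosure_ideal I : submod R I -> ideal R (wclosure I).
Proof.
move=> hI; split; last by move=> x [].
split=> [|x y [Rx hx] [Ry hy]|r x Rr [Rx hx]].
- by split=> [|M hM]; [sr | exact: sm0 (locm_submod hM hI)].
- split=> [|M hM]; first sr.
  by apply: (smD (locm_submod hM hI)); [exact: hx | exact: hy].
- split=> [|M hM]; first sr.
  by apply: (smZ (locm_submod hM hI)) => //; exact: hx.
Qed.

Lemma wclosure_wclosed I : wclosed (wclosure I).
Proof.
by move=> x Rx h; split=> // M hM; apply: (locm_idem hM _ (h M hM)) => y [_]; exact.
Qed.

Lemma wclosed_tmax M : tmax R M -> wclosed M.
Proof.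
by move=> hM x Rx /(_ M hM) [s [Rs ns Msx]]; case: (tmax_prime hM Rs Rx Msx).
Qed.

Lemma in_wclosure (I : K -> Prop) x : R x -> I x -> wclosure I x.
Proof. by move=> Rx Ix; split=> // M hM; exact: locm_in. Qed.

(** * Consequences of w-stability *)

Hypothesis hS : w_stable R.

Lemma w_stable_locally I : ideal R I -> nonzero I -> wclosed I ->
  forall M, tmax R M -> exists s, [/\ R s, ~ M s & modprod I (colon (Eend I) I) s].
Proof.
move=> iI nI cI M hM; have hI : submod R I by case: iI.
have e := hS (wclosed_w_ideal iI nI cI).
have : wop R (modprod I (colon (Eend I) I)) 1 by apply/e => y; rewrite mul1r.
move=> /wopP => /(_ (submod_modprod _ hI)) /(_ M hM) [s [Rs ns h]].
by exists s; split=> //; rewrite -[s]mulr1.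
Qed.

Section Localization.
Variable M : K -> Prop.
Hypothesis hM : tmax R M.
Let D := locm M R.
Let hD : subring D := locm_subring hM (fun x Rx => Rx) hR.

Lemma locm_inv s : R s -> ~ M s -> D s^-1.
Proof.
move=> Rs ns; exists s; split=> //; have s0 : s != 0.
  by apply/eqP => s0; apply: ns; rewrite s0; exact: sm0 (tmax_submod hM).
by rewrite divff //; sr.
Qed.

Lemma nonunit_locm x : nonunit D x <-> locm M M x.
Proof.
have hMs := tmax_submod hM.
split=> [[[s [Rs ns Rsx]] nu]|[s [Rs ns Msx]]].
  exists s; split=> //; apply: contrapT => nsx; apply: nu.
  have x0 : x != 0.
    by apply/eqP => x0; apply: nsx; rewrite x0 mulr0; exact: sm0 hMs.
  split=> //; first by exists s.
  by exists (s * x); split=> //; rewrite mulfK.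
split; first by exists s; split=> //; exact: (tmax_sub hM).
move=> [_ x0 [t [Rt nt Rtx]]]; apply: (tmax_primeC hM Rs Rt ns nt).
have -> : s * t = s * x * (t * x^-1) by field.
exact: (smZr hMs).
Qed.

Lemma locm_quotient_field : is_quotient_field D.
Proof.
move=> x; have [a [b [Ra Rb b0 ->]]] := hq x.
by exists a, b; split=> //; exact: locm_in.
Qed.

Lemma locm_local x y : nonunit D x -> nonunit D y -> nonunit D (x + y).
Proof.
move=> /nonunit_locm hx /nonunit_locm hy; apply/nonunit_locm.
exact: (smD (locm_submod hM (tmax_submod hM))).
Qed.

(** The fractional ideal I contracts to the intersection of dI with R, a w-ideal since elements
    outside M act invertibly on I. Its stability at M is carried back by scaling with d. *)
Lemma locm_stable I : submod D I -> nonzero I -> fractional D I ->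
  modprod I (fun g => forall y z, I y -> I z -> I (g * y * z)) 1.
Proof.
move=> hI nI [d [d0 hd]].
have RD : ksubset R D by move=> r; exact: locm_in.
have IV s x : R s -> ~ M s -> I (s * x) -> I x.
  move=> Rs ns Ix; have s0 : s != 0.
    by apply/eqP => s0; apply: ns; rewrite s0; exact: sm0 (tmax_submod hM).
  by rewrite -(mulKf s0 x); apply: (smZ hI) => //; exact: locm_inv.
pose I' x := R x /\ I (x / d).
have iI' : ideal R I'.
  split; last by move=> x [].
  split=> [|x y [Rx Ix] [Ry Iy]|r x Rr [Rx Ix]].
  - by split; [sr | rewrite mul0r; exact: sm0 hI].
  - by split; [sr | rewrite mulrDl; exact: (smD hI)].
  - by split; [sr | rewrite -mulrA; apply: (smZ hI) => //; exact: RD].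
have lift y : I y -> exists s, [/\ R s, ~ M s & I' (s * d * y)].
  move=> Iy; have [s [Rs ns Rsy]] := hd _ Iy; exists s; split=> //.
  split; first by rewrite -mulrA.
  have -> : s * d * y / d = s * y by field.
  by apply: (smZ hI) => //; exact: RD.
have nI' : nonzero I'.
  have [y [Iy y0]] := nI; have [s [Rs ns Iy']] := lift y Iy.
  exists (s * d * y); split=> //; rewrite !mulf_neq0 //.
  by apply/eqP => s0; apply: ns; rewrite s0; exact: sm0 (tmax_submod hM).
have cI' : wclosed I'.
  move=> x Rx /(_ M hM) [s [Rs ns [_ Isx]]]; split=> //.
  by apply: (IV s) => //; rewrite mulrA.
have [s [Rs ns hs]] := w_stable_locally iI' nI' cI' hM.
have s0 : s != 0 by apply/eqP => s0; apply: ns; rewrite s0; exact: sm0 (tmax_submod hM).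
rewrite -(mulVf s0); apply: (smZ (submod_modprod _ hI)); first exact: locm_inv.
move: s hs {Rs ns s0}; apply: modprod_ind => [|x y|f g [_ If] Ig].
- exact: modprod0.
- exact: modprodD.
have -> : f * g = f / d * (d * g) by field.
apply: modprodM => // y z Iy Iz.
have [s [Rs ns Iy']] := lift y Iy; have [t [Rt nt Iz']] := lift z Iz.
have [_ h] := Ig _ Iy' _ Iz'.
apply: (IV (s * t)); [sr|exact: tmax_primeC|].
by move: h; congr I; field.
Qed.

Lemma locm_prin (T J : K -> Prop) : subring T -> ksubset R T ->
  submod T J -> nonzero J -> ksubset J T ->
  exists w, [/\ J w, w != 0 & forall y z, J y -> J z -> locm M J (y * z / w)].
Proof.
move=> hT RT hJ nJ JT; have hJR := submod_le RT hJ.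
have hL := locm_submod hM hJR.
have [|||||w [[s [Rs ns Jw]] w0 hw]] := @overring_ideal_prin K D hD locm_quotient_field
    locm_local locm_stable (locm M T) (locm M J).
- exact: locm_subring.
- by move=> x [s [Rs ns Rx]]; exists s; split=> //; exact: RT.
- split; [exact: sm0 hL|exact: (smD hL)|].
  move=> r x [s [Rs ns Tr]] [t [Rt nt Jx]]; exists (s * t); split; [sr|exact: tmax_primeC|].
  by rewrite mulrACA; exact: (smZ hJ).
- by have [x [Jx x0]] := nJ; exists x; split=> //; exact: locm_in.
- by move=> x [s [Rs ns Jx]]; exists s; split=> //; exact: JT.
have s0 : s != 0 by apply/eqP => s0; apply: ns; rewrite s0; exact: sm0 (tmax_submod hM).
exists (s * w); split=> //; first by rewrite mulf_neq0.
move=> y z Jy Jz; apply: (locm_cancel hM Rs ns).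
have -> : s * (y * z / (s * w)) = y * z / w by field; rewrite w0 s0.
by apply: hw; exact: locm_in.
Qed.

End Localization.

(* [inv_sq M] is the paper's [(E(M) : M)]. *)
Definition inv_sq (M : K -> Prop) (x : K) := forall a b, M a -> M b -> M (x * a * b).

Lemma inv_sq_submod M : tmax R M -> submod R (inv_sq M).
Proof.
move=> hM; have hMs := tmax_submod hM; split=> [a b _ _|x y hx hy a b Ma Mb|r x Rr hx a b Ma Mb].
- by rewrite !mul0r; exact: sm0 hMs.
- by rewrite !mulrDl; apply: (smD hMs); [exact: hx|exact: hy].
- by rewrite -!mulrA; apply: (smZ hMs) => //; rewrite mulrA; exact: hx.
Qed.

(** Maximality of M yields s in M outside N, and s^2 x is in M. *)
Lemma inv_sq_away M N x : tmax R M -> tmax R N -> M <> N -> inv_sq M x -> locm N R x.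
Proof.
move=> hM hN neq hx.
have [s Ms nNs] : exists2 s, M s & ~ N s.
  apply: contrapT => h; apply: neq; symmetry.
  case: hM => _ _ maxM; case: (hN) => tN pN _.
  apply/seteq_eq/maxM => // y My; apply: contrapT => nNy; apply: h; by exists y.
have Rs := tmax_sub hM Ms.
exists (s * s); split; [sr|exact: tmax_primeC|].
by rewrite mulrC mulrA; apply/(tmax_sub hM)/hx.
Qed.

(* Otherwise [N (E(N) : N)] would stay inside [N] after localization at [N]. *)
Lemma inv_sq_not_ring N : tmax R N -> nonzero N ->
  ~ (forall x y, inv_sq N x -> inv_sq N y -> locm N (inv_sq N) (x * y)).
Proof.
move=> hN nN hring; have hNs := tmax_submod hN.
have iN : ideal R N by split=> //; exact: tmax_sub.
have [s [Rs ns hs]] := w_stable_locally iN nN (wclosed_tmax hN) hN.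
have hE : submod R (Eend N).
  split=> [b _|x y hx hy b Nb|r x Rr hx b Nb].
  - by rewrite mul0r; exact: sm0 hNs.
  - by rewrite mulrDl; apply: (smD hNs); [exact: hx|exact: hy].
  - by rewrite -mulrA; apply: (smZ hNs) => //; exact: hx.
have hEl := locm_submod hN hE.
(* The element s outside N is a sum of products a g with a in N and g in (E(N) : N). Each g x is
   locally in (E(N) : N), so s x, and with it x, is locally in E(N). Applied to the g themselves,
   this puts s into N. *)
have key x : inv_sq N x -> locm N (Eend N) x.
  move=> hx; apply: (locm_cancel hN Rs ns).
  move: s hs {Rs ns}; apply: modprod_ind => [|p q|a g Na hg].
  - by rewrite mul0r; exact: sm0 hEl.
  - by rewrite mulrDl; exact: (smD hEl).
  have [t [Rt nt ht]] := hring g x (fun a b Na Nb => hg a Na b Nb) hx.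
  exists t; split=> // b Nb.
  by have -> : t * (a * g * x) * b = t * (g * x) * a * b by [ring]; exact: ht.
have : locm N N s.
  have hNl := locm_submod hN hNs.
  move: s hs {Rs ns}; apply: modprod_ind => [|p q|a g Na hg];
    [exact: sm0 hNl|exact: (smD hNl)|].
  have [t [Rt nt ht]] := key g (fun a b Na Nb => hg a Na b Nb).
  by exists t; split=> //; rewrite mulrCA mulrC; exact: ht.
by move=> [t [Rt nt Nts]]; exact: (tmax_primeC hN Rt Rs nt ns).
Qed.

(* The [t]-finite character, phrased for the selection of one witness per
   maximal [t]-ideal containing [c]: stability of the [w]-closure of
   [\sum_(M \ni c) c^2 (E(M) : M)] makes finitely many summands suffice. *)
Lemma finite_t_character (G : (K -> Prop) -> K -> Prop) c : R c -> c != 0 ->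
  (forall M, tmax R M -> exists w, G M w) ->
  exists F : seq K, (forall w, w \in F -> exists2 M, tmax R M & G M w) /\
    forall M, tmax R M -> M c -> exists2 w, w \in F & G M w.
Proof.
move=> Rc c0 hG.
(* Y is R plus the sum of the (E(M) : M) with c in M, and I = c^2 Y. The factor c^2 carries each of
   these summands into M. *)
pose gen x := x = 1 \/ exists M, [/\ tmax R M, M c & inv_sq M x].
pose Y := modprod R gen; pose I x := Y (x / c ^+ 2).
have c20 : c ^+ 2 != 0 by rewrite expf_neq0.
have hY : submod R Y := submod_modprod _ (submod_self hR).
have Y1 : Y 1 by rewrite -[1]mulr1; apply: modprodM; [sr | left].
have hI : submod R I.
  split=> [|x y|r x Rr]; rewrite /I; first by rewrite mul0r; exact: sm0 hY.
    by rewrite mulrDl; exact: (smD hY).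
  by rewrite -mulrA; exact: (smZ hY).
have IR : ksubset I R.
  move=> x; rewrite /I -{2}(divfK c20 x); move: (x / c ^+ 2) => {}x.
  move: x; apply: modprod_ind => [|x y ? ?|r x Rr [->|[M [hM Mc hx]]]].
  - by rewrite mul0r; sr.
  - by rewrite mulrDl; sr.
  - sr.
  - rewrite expr2 -!mulrA; apply: (srM hR) => //; apply: (tmax_sub hM).
    by rewrite mulrA; exact: hx.
have Ic : I (c ^+ 2) by rewrite /I divff.
pose Iw := wclosure I; pose C := colon (Eend Iw) Iw.
have [hIw IwR] : ideal R Iw by exact: wclosure_ideal.
have IIw : ksubset I Iw by move=> x Ix; apply: in_wclosure => //; exact: IR.
have hC : submod R C.
  split=> [b _ y _|x y hx hy a Ia b Ib|r x Rr hx a Ia b Ib].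
  - by rewrite !mul0r; exact: sm0 hIw.
  - by rewrite !mulrDl; apply: (smD hIw); [exact: hx|exact: hy].
  - by rewrite -!mulrA; apply: (smZ hIw) => //; rewrite mulrA; exact: hx.
have C1 : C 1 by move=> a Ia b Ib; rewrite mul1r; apply: (smZ hIw) => //; exact: IwR.
have hIC : submod R (modprod I C) := submod_modprod _ hI.
pose A x := R x /\ modprod I C x.
have iA : ideal R A.
  split; last by move=> x [].
  split=> [|x y [Rx Ix] [Ry Iy]|r x Rr [Rx Ix]].
  - by split; [sr | exact: modprod0].
  - by split; [sr | exact: modprodD].
  - by split; [sr | exact: (smZ hIC)].
have nA : nonzero A.
  exists (c ^+ 2); split=> //; split; first sr.
  by rewrite -[c ^+ 2]mulr1; exact: modprodM.
have [s [sA s0 hs]] : exists s : seq K, [/\ forall y, y \in s -> A y, exists2 y, y \in s & y != 0 & vseq s 1].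
  apply: unit_vseq => // N hN.
  have [||s [Rs ns hs]] := w_stable_locally _ _ (@wclosure_wclosed I) hN.
  - exact: wclosure_ideal.
  - by exists (c ^+ 2); split=> //; exact: IIw.
  have : locm N (modprod I C) s.
    have hL := locm_submod hN hIC; move: s hs {Rs ns}; apply: modprod_ind => [|x y|a g [_ /(_ N hN) [s [Rs ns Ia]]] hg].
    - exact: sm0 hL.
    - exact: (smD hL).
    by exists s; split=> //; rewrite mulrA; exact: modprodM.
  move=> [t [Rt nt h]]; exists (t * s); last exact: tmax_primeC.
  by split=> //; sr.
pose C2 x := C (x / c ^+ 2).
have hC2 : submod R C2.
  split=> [|x y|r x Rr]; rewrite /C2; first by rewrite mul0r; exact: sm0 hC.
    by rewrite mulrDl; exact: (smD hC).
  by rewrite -mulrA; exact: (smZ hC).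
pose good (F : seq K) := forall w, w \in F -> exists2 M, tmax R M & G M w.
pose sel (F : seq K) N := exists2 w, w \in F & G N w.
have good_cat F F' : good F -> good F' -> good (F ++ F').
  by move=> gF gF' w; rewrite mem_cat => /orP [/gF|/gF'].
have sel_cat F F' N : ~ sel (F ++ F') N -> ~ sel F N /\ ~ sel F' N.
  by move=> n; split=> -[w wF hw]; apply: n; exists w; rewrite // mem_cat wF ?orbT.
(* An element of Y involves finitely many M, and F collects a witness for each. If none of these
   works for N, then N differs from all those M, and y is in R_N by [inv_sq_away]. *)
have selY y : Y y -> exists2 F, good F & forall N, tmax R N -> ~ sel F N -> locm N R y.
  move: y; apply: modprod_ind => [|x y [F gF hF] [F' gF' hF']|r x Rr].
  - exists [::] => // N hN _; apply: locm_in => //; sr.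
  - exists (F ++ F'); first exact: good_cat.
    move=> N hN /sel_cat [n n']; apply: (smD (locm_submod hN (submod_self hR))); auto.
  move=> [->|[M [hM Mc hx]]].
    by exists [::] => // N hN _; apply: locm_in => //; sr.
  have [w hw] := hG M hM; exists [:: w].
    by move=> v; rewrite inE => /eqP ->; exists M.
  move=> N hN n; apply: (smZ (locm_submod hN (submod_self hR))) => //.
  apply: (inv_sq_away hM hN _ hx) => e; apply: n; exists w; rewrite ?inE //.
  by rewrite -e.
have selIC x : modprod I C x -> exists2 F, good F & forall N, tmax R N -> ~ sel F N -> locm N C2 x.
  move: x; apply: modprod_ind => [|x y [F gF hF] [F' gF' hF']|a g Ia hg].
  - by exists [::] => // N hN _; apply: locm_in => //; exact: sm0 hC2.
  - exists (F ++ F'); first exact: good_cat.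
    move=> N hN /sel_cat [n n']; apply: (smD (locm_submod hN hC2)); auto.
  have [F gF hF] := selY _ Ia; exists F => // N hN n.
  have [t [Rt nt Ra]] := hF N hN n; exists t; split=> //.
  rewrite /C2; have -> : t * (a * g) / c ^+ 2 = t * (a / c ^+ 2) * g by ring.
  exact: (smZ hC).
have [F gF hF] : exists2 F, good F &
    forall x, x \in s -> forall N, tmax R N -> ~ sel F N -> locm N C2 x.
  elim: s {s0 hs} sA => [|x s IH] sA; first by exists [::].
  have [F gF hF] := IH (fun y ys => sA y (mem_behead (s := x :: s) ys)).
  have [_ /selIC [F' gF' hF']] := sA x (mem_head _ _).
  exists (F ++ F'); first exact: good_cat.
  move=> y; rewrite in_cons => /orP [/eqP ->|ys] N hN /sel_cat [n n']; auto.
exists F; split=> // N hN Nc; apply: contrapT => n.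
(* If N is not selected, h is locally in c^2 C, so x y is locally in Y for x, y in (E(N) : N). At N,
   the summands of Y for M other than N fall into R_N, so Y is locally inside (E(N) : N),
   contradicting [inv_sq_not_ring]. *)
have [h hs' nNh] := vseq_tmax hN s0 hs.
have [t [Rt nt Cth]] := hF h hs' N hN n.
have [Rh _] := sA h hs'.
apply: (inv_sq_not_ring hN); first by exists c.
move=> x y hx hy.
have genI z : inv_sq N z -> I (c ^+ 2 * z).
  move=> hz; rewrite /I mulrC mulKf // -[z]mul1r; apply: modprodM; first sr.
  by right; exists N.
have := Cth _ (IIw _ (genI x hx)) _ (IIw _ (genI y hy)).
move=> [_ /(_ N hN) [r [Rr nr]]].
rewrite /I; have -> : r * (t * h / c ^+ 2 * (c ^+ 2 * x) * (c ^+ 2 * y)) / c ^+ 2 = r * (t * h) * (x * y) by field.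
move=> Yxy; have hX := inv_sq_submod hN; have hXl := locm_submod hN hX.
have RX r' : R r' -> inv_sq N r'.
  move=> Rr' a b Na Nb; rewrite -mulrA; apply: (smZ (tmax_submod hN)) => //.
  by apply: (smZ (tmax_submod hN)) => //; exact: tmax_sub Na.
apply: (@locm_cancel _ hN _ (r * (t * h))); [sr|by do !apply: tmax_primeC => //; sr|].
move: Yxy; move: (_ * (x * y)); apply: modprod_ind; [exact: sm0 hXl|exact: (smD hXl)|].
move=> r' z Rr' [->|[M [hM Mc hz]]]; apply: (smZ hXl) => //.
  by apply: locm_in => //; apply: RX; sr.
have [<-|neq] := pselect (M = N); first exact: locm_in.
have [q [Rq nq Rqz]] := inv_sq_away hM hN neq hz.
by exists q; split=> //; exact: RX.
Qed.

End TIdeals.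

(** * Descent to a t-linked overring *)

Section Overring.
Variables (K : fieldType) (R T : K -> Prop).
Hypothesis hR : subring R.
Hypothesis hq : is_quotient_field R.
Hypothesis hT : subring T.
Hypothesis RT : ksubset R T.
Hypothesis hlink : t_linked R T.

(** Otherwise a finite list of elements of Q in R has 1 in its divisorial closure over R. Any u
    multiplying the list into T is then in T_w = T, so 1 is in the closure over T as well, hence in
    Q. *)
Lemma t_linked_tmax Q : tmax T Q -> exists2 M, tmax R M & forall x, R x -> Q x -> M x.
Proof.
move=> hQ; have hQs := tmax_submod hQ; apply: contrapT => h.
pose A x := R x /\ Q x.
have iA : ideal R A.
  split; last by move=> x [].
  split=> [|x y [Rx Qx] [Ry Qy]|r x Rr [Rx Qx]].
  - by split; [sr | exact: sm0 hQs].
  - by split; [sr | exact: (smD hQs)].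
  - by split; [sr | apply: (smZ hQs) => //; exact: RT].
have nA : nonzero A.
  have [[_ nQ _] _ _] := hQ.
  by have [c [Qc Rc c0]] := meets_D hq RT hQs nQ; exists c.
have [s [sA s0 hs]] : exists s : seq K, [/\ forall y, y \in s -> A y, exists2 y, y \in s & y != 0 & vseq R s 1].
  apply: (unit_vseq hR iA nA) => M hM; apply: contrapT => h'; apply: h; exists M => // x Rx Qx.
  by apply: contrapT => nMx; apply: h'; exists x.
apply: (tmax_n1 hQ); apply: (tmax_vseq hT hQ _ s0 (x := 1)).
  by move=> y /sA [].
move=> u hu; rewrite mul1r; apply/hlink.
apply/(wopP hR); first exact: submod_le RT (submod_self hT).
move=> M hM; have [y ys nMy] := vseq_tmax hR hM s0 hs.
by exists y; split=> //; [case: (sA _ ys) | rewrite mulrC; exact: hu].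
Qed.

(** Each Q has its trace on R inside some M, so denominators outside M are also outside Q. *)
Lemma w_ideal_locally (J : K -> Prop) x : w_ideal T J ->
  (forall M, tmax R M -> locm R M J x) -> J x.
Proof.
move=> [[hJ _] _ eJ] h; apply/eJ/(wopP hT) => // Q hQ.
have [M hM QM] := t_linked_tmax hQ; have [s [Rs ns Jsx]] := h M hM.
by exists s; split=> //; [exact: RT | move=> /(QM s Rs)].
Qed.

Hypothesis hS : w_stable R.

Lemma common_locm M (J : K -> Prop) (s : seq K) : tmax R M -> submod R J ->
  (forall x, x \in s -> locm R M J x) ->
  exists t, [/\ R t, ~ M t & forall x, x \in s -> J (t * x)].
Proof.
move=> hM hJ; elim: s => [|x s IH] hs.
  by exists 1; split=> //; [sr | exact: (tmax_n1 hM)].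
have [t [Rt nt ht]] := IH (fun y ys => hs y (mem_behead (s := x :: s) ys)).
have [r [Rr nr Jx]] := hs x (mem_head _ _).
exists (r * t); split; [sr|exact: (tmax_primeC hR hM)|].
move=> y; rewrite in_cons => /orP [/eqP ->|/ht Jy].
  by rewrite mulrAC; exact: (smZr hJ).
by rewrite -mulrA; exact: (smZ hJ).
Qed.

(** A finite list from J contains a local generator at every maximal t-ideal of R; w is the one at
    an M containing the trace of Q. Then g = s/w, where s outside M clears the denominators of all
    yz/w with y, z in the list. *)
Lemma t_linked_locally_stable J Q : w_ideal T J -> tmax T Q ->
  exists w g, [/\ J w, forall y z, J y -> J z -> J (g * y * z), T (w * g) & ~ Q (w * g)].
Proof.
move=> wJ hQ; have [[hJ JT] nJ _] := wJ; have hJR := submod_le RT hJ.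
pose G M w := [/\ J w, w != 0 & forall y z, J y -> J z -> locm R M J (y * z / w)].
have hG M : tmax R M -> exists w, G M w.
  by move=> hM; exact: (locm_prin hR hq hS hM hT RT hJ nJ JT).
have [c [Jc Rc c0]] := meets_D hq RT hJ nJ.
have [F [gF hF]] := finite_t_character hR hq hS Rc c0 hG.
have FJ w : w \in c :: F -> J w.
  by rewrite in_cons => /orP [/eqP ->|/gF [M _ []]].
have {}hF M : tmax R M -> exists2 w, w \in c :: F & G M w.
  move=> hM; have [/(hF M hM) [w wF hw]|nMc] := pselect (M c).
    by exists w; rewrite // in_cons wF orbT.
  (* Where c is outside M it is locally a unit and can itself be the generator. *)
  exists c; rewrite ?mem_head //; split=> // y z Jy Jz; exists c; split=> //.
  by rewrite mulrCA divff // mulr1; apply: (smZ hJ) => //; exact: JT.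
have [M hM QM] := t_linked_tmax hQ.
have [w wF [Jw w0 hw]] := hF M hM.
have [s [Rs ns hs]] : exists s, [/\ R s, ~ M s & forall x,
    x \in [seq y * z / w | y <- c :: F, z <- c :: F] -> J (s * x)].
  apply: common_locm => // x /allpairsP [[y z] [/= yF zF ->]].
  by apply: hw; exact: FJ.
exists w, (s / w); have -> : w * (s / w) = s by field.
split=> //; [|exact: RT|by move=> /(QM s Rs)].
(* At N with listed generator v, g v^2 = s v^2/w is in J. Multiplying by y/v and then by z/v stays
   locally in J and ends at g y z. *)
move=> y z Jy Jz; apply: w_ideal_locally => // N hN.
have [v vF [Jv v0 hv]] := hF N hN.
have Jsvv : J (s / w * v * v).
  have -> : s / w * v * v = s * (v * v / w) by ring.
  by apply: hs; apply/allpairsP; exists (v, v).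
have [t [Rt nt h1]] := hv _ _ Jsvv Jy.
have [r [Rr nr h2]] := hv _ _ h1 Jz.
exists (r * t); split; [sr|exact: (tmax_primeC hR hN)|].
by move: h2; congr J; field; rewrite v0 w0.
Qed.

End Overring.

Theorem theorem2p10 (K : fieldType) (R T : K -> Prop) :
  subring R -> is_quotient_field R -> (exists x, ~ R x) ->
  subring T -> ksubset R T -> t_linked R T ->
  w_stable R -> w_stable T.
Proof.
move=> hR hq _ hT RT hlink hS J wJ; have [[hJ JT] nJ eJ] := wJ.
have hE := submod_modprod (colon (Eend J) J) hJ.
have hJE : ksubset (modprod J (colon (Eend J) J)) (Eend J).
  apply: modprod_ind => [b _|x y hx hy b Jb|a g Ja hg b Jb].
  - by rewrite mul0r; exact: sm0 hJ.
  - by rewrite mulrDl; apply: (smD hJ); [exact: hx|exact: hy].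
  - by rewrite [a * g]mulrC; exact: hg.
(* For x in E(J), the element w g of J (E(J) : J) outside Q is a denominator. The converse holds
   because J equals its own w'-closure. *)
move=> x; split=> [/(wopP hT _ hE) hx b Jb|Ex]; last first.
  apply/(wopP hT) => // Q hQ.
  have [w [g [Jw hg Twg nwg]]] := t_linked_locally_stable hR hq hT RT hlink hS wJ hQ.
  exists (w * g); split=> //.
  have -> : w * g * x = x * w * g by ring.
  by apply: modprodM; [exact: Ex | move=> y Jy z Jz; exact: hg].
apply/eJ/(wopP hT) => // Q hQ; have [s [Ts ns h]] := hx Q hQ.
by exists s; split=> //; rewrite mulrA; exact: hJE h b Jb.
Qed.
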